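(* Let $(M,\omega,I)$ be a (pseudo-)Kähler manifold and let $\star$ be a star product of Wick type on $(M,\omega,I)$ with Karabegov's characterizing form $K(\star)$. Assume that $X$ is a (complex-valued) smooth vector field on $M$ which is a derivation of $\star$. Then $X$ is even quasi-inner if and only if there is a formal function $a\in C^\infty(M)[[\nu]]$ such that $$da=i_XK(\star),$$ and then $$X(b)=X^\omega_{a_0}(b)=-\frac1\nu\,\mathrm{ad}_\star(a)b\qquad\text{for all } b\in C^\infty(M)[[\nu]],$$ where $a=a_0+a_+$ with $a_0\in C^\infty(M)$ and $a_+\in\nu C^\infty(M)[[\nu]]$, and $X^\omega_{a_0}$ denotes the Hamiltonian vector field of $a_0$ with respect to $\omega$.
   Context: Conventions. Kähler manifolds $(M,\omega,I)$ (symplectic form $\omega$, complex structure $I$) include pseudo-Kähler manifolds: no positivity of $\omega(\cdot,I\cdot)$ is assumed. $C^\infty(M)$ denotes complex-valued smooth functions; vector fields and forms are complex-valued as well. $\nu$ is a formal parameter; operations on functions, forms etc. are extended $\nu$-linearly to formal power series. Summation convention is used. Hamiltonian vector fields and Poisson bracket: $i_{X^\omega_f}\omega=df$ and $\{f,g\}=-X^\omega_f(g)$. A star product on $(M,\omega)$ is an associative $\mathbb C[[\nu]]$-bilinear product $a\star b=\sum_{r\ge 0}\nu^rC_r(a,b)$ on $C^\infty(M)[[\nu]]$ with bidifferential operators $C_r$, $C_0(a,b)=ab$, $C_1(a,b)-C_1(b,a)=\{a,b\}$ and $1\star a=a\star 1=a$. Being given by bidifferential operators, $\star$ restricts to open subsets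 of $M$. We write $\mathrm{ad}_\star(a)b=a\star b-b\star a$. A star product is of Wick type on $(M,\omega,I)$ if in local holomorphic coordinates, for $r\ge1$, $C_r(a,b)=\sum_{K,\bar L}C_r^{K;\bar L}\frac{\partial^{|K|}a}{\partial z^K}\frac{\partial^{|\bar L|}b}{\partial \bar z^L}$ with local coefficient functions $C_r^{K;\bar L}$ (only holomorphic derivatives of the first argument and only anti-holomorphic derivatives of the second). Karabegov's characterizing form: write $Z_k=\partial_{z^k}$, $\bar Z_l=\partial_{\bar z^l}$. On every contractible domain $U$ of a holomorphic chart $(z,U)$ there exist $u_k,\bar v_l\in C^\infty(U)[[\nu]]$ such that $a\star u_k=au_k+\nu Z_k(a)$ and $\bar v_l\star a=\bar v_l a+\nu\bar Z_l(a)$ for all $a\in C^\infty(U)[[\nu]]$. The form $K(\star)$ is defined by $K(\star)|_U=\bar\partial(-u_k\,dz^k)=\partial(\bar v_l\,d\bar z^l)$; by Karabegov this is a globally well-defined formal series of closed two-forms of type $(1,1)$ on $M$ with $K(\star)=\omega+O(\nu)$. A vector field $X$ acts $\nu$-linearly on $C^\infty(M)[[\nu]]$; it is a derivation of $\star$ if $X(a\star b)=X(a)\star b+a\star X(b)$ for all $a,b$. A derivation $X$ of $\star$ is called quasi-inner if there is some $a\in C^\infty(M)[[\nu]]$ with $X(b)=-\frac1\nu\mathrm{ad}_\star(a)b$ for all $b\in C^\infty(M)[[\nu]]$. *)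

(* Defs.v *)
From HB Require Import structures.
From mathcomp Require Import all_boot all_order all_algebra.
From mathcomp Require Import all_classical all_reals all_analysis.
From mathcomp Require Import complex.

Set Implicit Arguments.
Unset Strict Implicit.
Unset Printing Implicit Defensive.
Import Order.TTheory GRing.Theory Num.Theory.
Import numFieldNormedType.Exports.
Local Open Scope classical_set_scope.
Local Open Scope ring_scope.

(* C^n is identified with R^(2n) = 'rV[R]_(n + n): the first block holds the
   real parts x^k and the second block the imaginary parts y^k, so that
   z^k = x^k + i y^k.

   An index j : 'I_(n + n) is also used for the complex frame
   (Z_1, .., Z_n, Zbar_1, .., Zbar_n), in this order: hol k = lshift n k stands
   for d/dz^k and anti k = rshift n k for d/dzbar^k. *)

Notation hol := (lshift _) (only parsing).
Notation anti := (rshift _) (only parsing).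

Section Calculus.
Variables (R : realType) (m : nat).

Definition rpartial (j : 'I_m) (f : 'rV[R]_m -> R) : 'rV[R]_m -> R :=
  fun x => 'D_(delta_mx 0 j) f x.

(* C^oo on an open set D: all iterated partial derivatives exist and are
   continuous at every point of D. *)
Definition rsmooth (D : set 'rV[R]_m) (f : 'rV[R]_m -> R) : Prop :=
  forall (s : seq 'I_m) (x : 'rV[R]_m), D x ->
    {for x, continuous (foldr rpartial f s)} /\
    forall j : 'I_m, derivable (foldr rpartial f s) x (delta_mx 0 j).

Definition csmooth (D : set 'rV[R]_m) (g : 'rV[R]_m -> R[i]) : Prop :=
  rsmooth D (fun x => complex.Re (g x)) /\
  rsmooth D (fun x => complex.Im (g x)).

Definition cpartial (j : 'I_m) (g : 'rV[R]_m -> R[i]) : 'rV[R]_m -> R[i] :=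
  fun x => (rpartial j (fun y => complex.Re (g y)) x +i*
            rpartial j (fun y => complex.Im (g y)) x)%C.

End Calculus.

Section Wirtinger.
Variables (R : realType) (n : nat).

Definition wirtinger (j : 'I_(n + n)) (g : 'rV[R]_(n + n) -> R[i]) :
    'rV[R]_(n + n) -> R[i] :=
  fun x => match fintype.split j with
  | inl k => (cpartial (lshift n k) g x - 'i%C * cpartial (rshift n k) g x) / 2
  | inr k => (cpartial (lshift n k) g x + 'i%C * cpartial (rshift n k) g x) / 2
  end.

Definition zcoord (k : 'I_n) (x : 'rV[R]_(n + n)) : R[i] :=
  (x ord0 (lshift n k) +i* x ord0 (rshift n k))%C.

Definition czcoord (j : 'I_(n + n)) (x : 'rV[R]_(n + n)) : R[i] :=
  match fintype.split j with
  | inl k => zcoord k x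
  | inr k => ((zcoord k x)^*)%C
  end.

Definition holomorphic (D : set 'rV[R]_(n + n))
    (g : 'rV[R]_(n + n) -> R[i]) : Prop :=
  csmooth D g /\
  forall (k : 'I_n) x, D x -> wirtinger (rshift n k) g x = 0.

Definition holomorphic_map (D : set 'rV[R]_(n + n))
    (F : 'rV[R]_(n + n) -> 'rV[R]_(n + n)) : Prop :=
  forall k : 'I_n, holomorphic D (fun x => zcoord k (F x)).

End Wirtinger.

Definition contractible (R : realType) (T : topologicalType) (U : set T) :
    Prop :=
  exists2 x0 : T, U x0 &
  exists H : R * T -> T,
    [/\ {within `[0%R, 1%R]%classic `*` U, continuous H},
        (forall t x, (0 <= t <= 1)%R -> U x -> U (H (t, x))),
        (forall x, U x -> H (0, x) = x) &
        (forall x, U x -> H (1, x) = x0)].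

(* phi and psi are total functions; they are meaningful only on dom and on
   phi @` dom respectively. *)
Record chart (R : realType) (n : nat) (T : topologicalType) := Chart {
  dom : set T;
  phi : T -> 'rV[R]_(n + n);
  psi : 'rV[R]_(n + n) -> T;
  dom_open : open dom;
  img_open : open (phi @` dom);
  phiK : forall p, dom p -> psi (phi p) = p;
  phi_cont : forall p, dom p -> {for p, continuous phi};
  psi_cont : forall x, (phi @` dom) x -> {for x, continuous psi}
}.

Definition compatible (R : realType) (n : nat) (T : topologicalType)
    (c c' : chart R n T) : Prop :=
  holomorphic_map (phi c @` (dom c `&` dom c')) (phi c' \o psi c) /\
  holomorphic_map (phi c' @` (dom c `&` dom c')) (phi c \o psi c').

(* The complex structure I is given by its maximal holomorphic atlas. *)
Record complexManifold (R : realType) (n : nat) := ComplexManifold {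
  cm_sort :> topologicalType;
  cm_hausdorff : hausdorff_space cm_sort;
  cm_second_countable : @second_countable cm_sort;
  atlas : set (chart R n cm_sort);
  atlas_cover : forall p, exists c, atlas c /\ dom c p;
  atlas_compat : forall c c', atlas c -> atlas c' -> compatible c c';
  atlas_max : forall c, (forall c', atlas c' -> compatible c c') -> atlas c
}.

Section Manifold.
Variables (R : realType) (n : nat) (M : complexManifold R n).

Let chartM := chart R n M.

Definition chart_at (p : M) : chartM := projT1 (cid (atlas_cover p)).

(* An element of C^oo(W), for W open, is represented by a total function on M
   whose values off W are irrelevant. *)
Definition smooth_on (W : set M) (f : M -> R[i]) : Prop :=
  forall c : chartM, atlas c -> csmooth (phi c @` (W `&` dom c)) (f \o psi c).

Definition smooth (f : M -> R[i]) : Prop := smooth_on setT f.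

Definition pd (c : chartM) (j : 'I_(n + n)) (f : M -> R[i]) : M -> R[i] :=
  fun p => wirtinger j (f \o psi c) (phi c p).

Definition coord (c : chartM) (j : 'I_(n + n)) : M -> R[i] :=
  fun p => czcoord j (phi c p).

Definition jacobian (c c' : chartM) (p : M) : 'M[R[i]]_(n + n) :=
  \matrix_(i, j) pd c i (coord c' j) p.

(* Complex vector fields and two-forms are given by their components in the
   frames (Z_k, Zbar_k) of the holomorphic charts: X = sum_j X_j d_j and
   w_{ij} = w(d_i, d_j). *)
Record vector_field := VectorField {
  vf_comp :> chartM -> M -> 'rV[R[i]]_(n + n);
  vf_smooth : forall c, atlas c -> forall j,
    smooth_on (dom c) (fun p => vf_comp c p ord0 j);
  vf_change : forall c c', atlas c -> atlas c' -> forall p, dom c p ->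
    dom c' p -> vf_comp c' p = vf_comp c p *m jacobian c c' p
}.

Record two_form := TwoForm {
  tf_comp :> chartM -> M -> 'M[R[i]]_(n + n);
  tf_smooth : forall c, atlas c -> forall i j,
    smooth_on (dom c) (fun p => tf_comp c p i j);
  tf_skew : forall c, atlas c -> forall p, dom c p -> forall i j,
    tf_comp c p i j = - tf_comp c p j i;
  tf_change : forall c c', atlas c -> atlas c' -> forall p, dom c p ->
    dom c' p ->
    tf_comp c p = jacobian c c' p *m tf_comp c' p *m (jacobian c c' p)^T
}.

Definition differential (f : M -> R[i]) (c : chartM) (p : M) :
    'rV[R[i]]_(n + n) := \row_j pd c j f p.

Definition contraction (X : chartM -> M -> 'rV[R[i]]_(n + n)) (w : two_form)
    (c : chartM) (p : M) : 'rV[R[i]]_(n + n) := X c p *m w c p.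

Definition vact (X : chartM -> M -> 'rV[R[i]]_(n + n)) (f : M -> R[i]) :
    M -> R[i] :=
  fun p => \sum_j X (chart_at p) p ord0 j * pd (chart_at p) j f p.

(* Symplectic forms for which I is a compatible complex structure, i.e. real
   symplectic forms of type (1,1); no positivity is required. *)
Definition pseudo_kahler (w : two_form) : Prop :=
  forall c, atlas c -> forall p, dom c p ->
    [/\ (forall i j k : 'I_(n + n),
           pd c i (fun q => w c q j k) p + pd c j (fun q => w c q k i) p
           + pd c k (fun q => w c q i j) p = 0),
        w c p \in unitmx,
        (forall k l : 'I_n, w c p (hol k) (hol l) = 0 /\
                            w c p (anti k) (anti l) = 0) &
        (forall k l : 'I_n,
           ((w c p (hol k) (anti l))^*)%C = w c p (anti k) (hol l))].

(* The solution X of contraction X w = differential f. *)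
Definition hamiltonian (w : two_form) (f : M -> R[i]) (c : chartM) (p : M) :
    'rV[R[i]]_(n + n) := differential f c p *m invmx (w c p).

Definition poisson (w : two_form) (f g : M -> R[i]) : M -> R[i] :=
  fun p => - vact (hamiltonian w f) g p.

(* del = sum_k dz^k /\ Z_k and dbar = sum_l dzbar^l /\ Zbar_l, applied to the
   one-form with components alpha; (dx /\ dy)(X, Y) = dx(X)dy(Y) - dx(Y)dy(X). *)
Definition is_anti (j : 'I_(n + n)) : bool := (n <= j)%N.

Definition dbar (c : chartM) (alpha : 'I_(n + n) -> M -> R[i]) (p : M) :
    'M[R[i]]_(n + n) :=
  \matrix_(i, j) ((if is_anti i then pd c i (alpha j) p else 0)
                  - (if is_anti j then pd c j (alpha i) p else 0)).

Definition del (c : chartM) (alpha : 'I_(n + n) -> M -> R[i]) (p : M) :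
    'M[R[i]]_(n + n) :=
  \matrix_(i, j) ((if is_anti i then 0 else pd c i (alpha j) p)
                  - (if is_anti j then 0 else pd c j (alpha i) p)).

Definition form10 (a : 'I_n -> M -> R[i]) (j : 'I_(n + n)) : M -> R[i] :=
  match fintype.split j with inl k => a k | inr _ => fun=> 0 end.

Definition form01 (a : 'I_n -> M -> R[i]) (j : 'I_(n + n)) : M -> R[i] :=
  match fintype.split j with inl _ => fun=> 0 | inr k => a k end.

(* The series sum_m nu^m a_m is represented by m |-> a_m. *)
Definition fseries := nat -> M -> R[i].

Definition fsmooth_on (W : set M) (a : fseries) : Prop :=
  forall m, smooth_on W (a m).

Definition fsmooth (a : fseries) : Prop := fsmooth_on setT a.

Definition fone : fseries := fun m _ => (m == 0%N)%:R.

Definition fmul (a b : fseries) : fseries :=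
  fun m p => \sum_(i < m.+1) a i p * b (m - i)%N p.

Definition numul (a : fseries) : fseries :=
  fun m p => if m is m'.+1 then a m' p else 0.

Definition fvact (X : chartM -> M -> 'rV[R[i]]_(n + n)) (a : fseries) :
    fseries := fun m => vact X (a m).

Definition multi_pd (c : chartM) (d N : nat) (e : 'I_d -> 'I_(n + n))
    (K : {ffun 'I_d -> 'I_N.+1}) (f : M -> R[i]) : M -> R[i] :=
  foldr (fun k g => iter (K k) (pd c (e k)) g) f (enum 'I_d).

(* B is locally a finite sum of products of derivatives of the first argument
   in the directions e1 and of the second argument in the directions e2.  The
   formula is required for functions defined on an arbitrary open W only, which
   fixes the restriction of B to open subsets. *)
Definition bidiff_along (d1 d2 : nat) (e1 : 'I_d1 -> 'I_(n + n))
    (e2 : 'I_d2 -> 'I_(n + n))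
    (B : (M -> R[i]) -> (M -> R[i]) -> M -> R[i]) : Prop :=
  forall c : chartM, atlas c -> forall p, dom c p ->
  exists V : set M, [/\ open V, V p, V `<=` dom c &
  exists (N : nat)
    (coef : {ffun 'I_d1 -> 'I_N.+1} -> {ffun 'I_d2 -> 'I_N.+1} -> M -> R[i]),
    (forall K L, smooth_on V (coef K L)) /\
    forall (W : set M) (a b : M -> R[i]), open W -> W `<=` V ->
      smooth_on W a -> smooth_on W b -> forall q, W q ->
      B a b q = \sum_K \sum_L
        coef K L q * multi_pd c e1 K a q * multi_pd c e2 L b q].

Definition bidifferential (B : (M -> R[i]) -> (M -> R[i]) -> M -> R[i]) :
    Prop := bidiff_along id id B.

Definition star_mul (C : nat -> (M -> R[i]) -> (M -> R[i]) -> M -> R[i])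
    (a b : fseries) : fseries :=
  fun m p => \sum_(r < m.+1) \sum_(i < (m - r).+1)
    C r (a i) (b (m - r - i)%N) p.

Record star_product (w : two_form) := StarProduct {
  sp_coef : nat -> (M -> R[i]) -> (M -> R[i]) -> M -> R[i];
  sp_bidiff : forall r, bidifferential (sp_coef r);
  sp_assoc : forall a b c, fsmooth a -> fsmooth b -> fsmooth c -> forall m p,
    star_mul sp_coef (star_mul sp_coef a b) c m p =
    star_mul sp_coef a (star_mul sp_coef b c) m p;
  sp_C0 : forall a b, smooth a -> smooth b -> forall p,
    sp_coef 0 a b p = a p * b p;
  sp_C1 : forall a b, smooth a -> smooth b -> forall p,
    sp_coef 1 a b p - sp_coef 1 b a p = poisson w a b p;
  sp_unitl : forall a, fsmooth a -> forall m p,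
    star_mul sp_coef fone a m p = a m p;
  sp_unitr : forall a, fsmooth a -> forall m p,
    star_mul sp_coef a fone m p = a m p
}.

Section Star.
Variables (w : two_form) (S : star_product w).

Definition star : fseries -> fseries -> fseries := star_mul (sp_coef S).

Definition ad_star (a b : fseries) : fseries :=
  fun m p => star a b m p - star b a m p.

Definition wick_type : Prop :=
  forall r, (0 < r)%N ->
    bidiff_along (fun k : 'I_n => hol k) (fun k : 'I_n => anti k)
      (sp_coef S r).

Definition karabegov_u (c : chartM) (u : 'I_n -> fseries) : Prop :=
  (forall k, fsmooth_on (dom c) (u k)) /\
  forall k (a : fseries), fsmooth_on (dom c) a -> forall m p, dom c p ->
    star a (u k) m p =
    fmul a (u k) m p + numul (fun m' => pd c (hol k) (a m')) m p.

Definition karabegov_v (c : chartM) (v : 'I_n -> fseries) : Prop :=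
  (forall l, fsmooth_on (dom c) (v l)) /\
  forall l (a : fseries), fsmooth_on (dom c) a -> forall m p, dom c p ->
    star (v l) a m p =
    fmul (v l) a m p + numul (fun m' => pd c (anti l) (a m')) m p.

(* K is Karabegov's characterizing form of the star product: on contractible
   holomorphic charts it is given by any local functions u_k, vbar_l solving
   the equations above, and such functions exist around every point. *)
Definition characterizing_form (K : nat -> two_form) : Prop :=
  (forall c, atlas c -> contractible R (dom c) ->
     (forall u, karabegov_u c u -> forall m p, dom c p ->
        K m c p = dbar c (form10 (fun k q => - u k m q)) p) /\
     (forall v, karabegov_v c v -> forall m p, dom c p ->
        K m c p = del c (form01 (fun l => v l m)) p)) /\
  (forall p, exists c, [/\ atlas c, dom c p, contractible R (dom c),
     (exists u, karabegov_u c u) & (exists v, karabegov_v c v)]).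

Definition star_derivation (X : vector_field) : Prop :=
  forall a b, fsmooth a -> fsmooth b -> forall m p,
    fvact X (star a b) m p = star (fvact X a) b m p + star a (fvact X b) m p.

(* X(b) = - (1/nu) ad(a) b, multiplied by nu. *)
Definition implements (a : fseries) (X : vector_field) : Prop :=
  forall b, fsmooth b -> forall m p,
    numul (fvact X b) m p = - ad_star a b m p.

Definition quasi_inner (X : vector_field) : Prop :=
  exists2 a : fseries, fsmooth a & implements a X.

End Star.

Definition is_potential (a : fseries) (X : vector_field)
    (K : nat -> two_form) : Prop :=
  forall m c, atlas c -> forall p, dom c p ->
    differential (a m) c p = contraction X (K m) c p.

End Manifold.

(* Main.v *)
(* In holomorphic coordinates z^k, functions h with dh of type (1,0) satisfy
   b * h = b h for the star product, because C_r only differentiates its second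
   argument anti-holomorphically and C_r(b, 1) = 0; conversely z^k * f = z^k f
   for all k forces f to be holomorphic, order by order in nu, since C_1
   antisymmetrizes to the nondegenerate Poisson bracket.  In degree 1 the
   derivation property of X gives C_1(z^j, X z^k) = 0, so the components X^k are
   holomorphic, whence b * (X^k u_k) = X^k (b u_k + nu Z_k b).  Therefore, if X
   is implemented by a, then a - X^k u_k is star-multiplied by z^j pointwise, so
   it is holomorphic, which is the (0,1) part of da = i_X K; conversely that
   part gives b * a = a b + nu X^k Z_k b.  The (1,0) part is the same argument
   for the opposite product and the functions v_l.  Bump functions transfer the
   hypotheses, given for global functions, to functions on a chart. *)
Require Import Defs.
From HB Require Import structures.
From mathcomp Require Import all_boot all_order all_algebra.
From mathcomp Require Import all_classical all_reals all_analysis.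
From mathcomp Require Import complex.
From mathcomp Require Import ring lra.

Set Implicit Arguments.
Unset Strict Implicit.
Unset Printing Implicit Defensive.
Import Order.TTheory GRing.Theory Num.Theory.
Import numFieldNormedType.Exports.
Local Open Scope classical_set_scope.
Local Open Scope ring_scope.

Local Notation coord := Defs.coord.
Local Notation jacobian := Defs.jacobian.
Local Notation contraction := Defs.contraction.

(** Each half of the argument occurs twice, for the product and for its opposite. It is carried out
    once, over an abstract triple [C], [e1], [e2] stable under the exchange; the only asymmetry is a
    sign. As K is both dbar of -u_k dz^k and del of v_l dzbar^l, the (0,1) part of i_X K is X^k dbar
    u_k, whereas the (1,0) part is minus Xbar^l del v_l. Commutators also change sign in the
    opposite product, so one scalar [s], equal to 1 or -1, serves both cases. The analytic obstacle
    is that smoothness means existence and continuity of all iterated partial derivatives: neither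
    products nor compositions with transition maps are immediate. Products are treated through a
    syntactic class of functions closed under differentiation; it contains the family t^-k
    exp(-1/t), so that bump functions belong to it. The chain rule rests on continuous partial
    derivatives implying differentiability. *)

(** * Real differential calculus *)

Section DirectionalDerivative.
Variables (R : realType) (V : normedModType R).
Implicit Types (f g : V -> R) (x v : V).

(** Both sides have literally the same difference quotient; this makes one-variable calculus
    available for directional derivatives. *)
Lemma is_derive_line f x v (df : R) :
  is_derive x v f df <-> is_derive (0 : R) 1 (fun t : R => f (t *: v + x)) df.
Proof.
have e : (fun h : R => h^-1 *: ((f \o shift x) (h *: v) - f x)) =
   (fun h : R => h^-1 *:
      (((fun t : R => f (t *: v + x)) \o shift (0 : R)) (h *: (1 : R))
       - (fun t : R => f (t *: v + x)) 0)).
  by apply/funext => h /=; rewrite addr0 scale0r add0r [_%:A]mulr1.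
split=> -[d1 d2]; apply: DeriveDef.
- by move: d1; rewrite /derivable e.
- by move: d2; rewrite /derive e.
- by move: d1; rewrite /derivable -e.
- by move: d2; rewrite /derive -e.
Qed.

Lemma is_derive_comp_scalar (h : R -> R) f x v (dh df : R) :
  is_derive x v f df -> is_derive (f x) (1 : R) h dh ->
  is_derive x v (h \o f) (dh * df).
Proof.
move=> /is_derive_line fd hd; apply/is_derive_line.
apply: (@is_derive1_comp _ h (fun t : R => f (t *: v + x))).
by rewrite scale0r add0r.
Qed.

Lemma open_eq_is_derive (D : set V) f g x v (df : R) : open D -> D x ->
  {in D, f =1 g} -> is_derive x v f df -> is_derive x v g df.
Proof.
move=> oD Dx fg; apply: near_eq_is_derive.
by near=> y; apply: fg; rewrite inE; near: y; exact: open_nbhs_nbhs.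
Unshelve. all: by end_near. Qed.

End DirectionalDerivative.

(* theta k t = t^-k exp(-1/t) for t > 0; the family is closed under
   derivatives, so each member is smooth on the whole line. *)
Section Theta.
Variable R : realType.

Definition theta (k : nat) (t : R) : R :=
  if 0 < t then t^-1 ^+ k * expR (- t^-1) else 0.

Lemma theta_le0 k t : t <= 0 -> theta k t = 0.
Proof. by rewrite /theta leNgt => /negbTE ->. Qed.

Lemma theta_ge0 k t : 0 <= theta k t.
Proof.
rewrite /theta; case: ifPn => // t0.
by rewrite mulr_ge0 ?expR_ge0 // exprn_ge0 // invr_ge0 ltW.
Qed.

Lemma theta_gt0 k t : 0 < t -> 0 < theta k t.
Proof. by move=> t0; rewrite /theta t0 mulr_gt0 ?expR_gt0 // exprn_gt0 // invr_gt0. Qed.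

(** One term of the exponential series at 1/t, of order k+2, absorbs t^-k and leaves t^2. A
    quadratic bound is what the difference quotient at 0 needs. *)
Lemma theta_bound k t : 0 < t -> theta k t <= (k.+2)`!%:R * t ^+ 2.
Proof.
move=> t0; rewrite /theta t0 expRN.
have ti : 0 < t^-1 by rewrite invr_gt0.
have le1 : t^-1 ^+ k.+2 / (k.+2)`!%:R <= expR t^-1.
  have := @expR_ge1Dxn R t^-1 k.+1 (ltW ti).
  by apply: le_trans; rewrite lerDr.
have f0 : (0 : R) < (k.+2)`!%:R by rewrite ltr0n fact_gt0.
rewrite ler_pdivrMr ?expR_gt0 //.
apply: (@le_trans _ _ ((k.+2)`!%:R * t ^+ 2 * (t^-1 ^+ k.+2 / (k.+2)`!%:R))).
  rewrite le_eqVlt; apply/orP; left; apply/eqP.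
  rewrite -addn2 exprD !exprVn; field.
  by rewrite expf_neq0 ?gt_eqF //= gt_eqF.
by rewrite ler_wpM2l // mulr_ge0 ?ltW // exprn_gt0.
Qed.

Lemma is_derive_theta k t :
  is_derive t (1 : R) (theta k) (theta k.+2 t - k%:R * theta k.+1 t).
Proof.
have [t0|t0|->] := ltgtP t 0.
- rewrite !theta_le0 ?ltW // mulr0 subr0.
  apply: (@open_eq_is_derive R R [set t | t < 0] (cst 0) (theta k) t 1 0) => //.
  by move=> y; rewrite inE /= => y0; rewrite theta_le0 // ltW.
- rewrite /theta t0.
  apply: (@open_eq_is_derive R R [set t | 0 < t]
    (fun t => t^-1 ^+ k * expR (- t^-1)) (theta k)) => //.
  by move=> y; rewrite inE /= => y0; rewrite /theta y0.
  have tn : t != 0 by rewrite gt_eqF.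
  have iv : is_derive t (1 : R) (fun t : R => t^-1) (- t^-1 ^+ 2).
    have := @is_deriveV R id t 1 1 tn (is_derive_id t 1).
    by rewrite [_ *: _]mulr1 exprVn.
  have e1 : is_derive t (1 : R) (fun t : R => t^-1 ^+ k)
      (k%:R * t^-1 ^+ k.-1 * - t^-1 ^+ 2).
    by have := is_deriveX k iv; rewrite exprfctE.
  have e2 := @is_derive_comp_scalar _ _ (@expR R) _ _ _ _ _
    (is_deriveN iv) (is_derive_expR _).
  apply: (is_derive_eq (is_deriveM e1 e2)).
  rewrite /= opprK /GRing.scale /=.
  by case: k {e1} => [|k] /=; rewrite !exprS; ring.
- have z j : theta j 0 = 0 by rewrite theta_le0.
  rewrite !z mulr0 subr0.
  (* For h > 0 the quotient is at most (k+2)! h by [theta_bound], for h < 0 it is zero. *)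
  have lim0 : h^-1 *: ((theta k \o shift 0) (h *: (1 : R)) - theta k 0)
      @[h --> 0^'] --> (0 : R).
    apply/cvgr0Pnorm_le => e e0.
    near=> h.
    have hn : h != 0 by near: h; exact: nbhs_dnbhs_neq.
    rewrite /= z subr0 addr0 [h *: 1]mulr1.
    have [h0|h0] := leP h 0; first by rewrite theta_le0 // scaler0 normr0 ltW.
    rewrite normrM normfV (gtr0_norm h0) ger0_norm ?theta_ge0 // ler_pdivrMl //.
    apply: (le_trans (theta_bound k h0)).
    rewrite expr2 mulrA mulrC ler_pM2l // mulrC -ler_pdivlMr ?ltr0n ?fact_gt0 //.
    rewrite -(gtr0_norm h0); near: h; apply: dnbhs0_le.
    by rewrite divr_gt0 // ltr0n fact_gt0.
  by apply: DeriveDef; [apply/cvg_ex; exists 0|exact: cvg_lim].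
Unshelve. all: by end_near. Qed.

End Theta.

(** * Closure properties of smooth real functions *)

Section RealSmooth.
Variables (R : realType) (m : nat).
Notation V := 'rV[R]_m.
Implicit Types (D : set V) (f g : V -> R).

Lemma rsmooth_subset D D' f : D' `<=` D -> rsmooth D f -> rsmooth D' f.
Proof. by move=> DD' fs s x /DD'; exact: fs. Qed.

Lemma rsmooth_partial D f j : rsmooth D f -> rsmooth D (rpartial j f).
Proof.
move=> fs s x Dx; have [] := fs (rcons s j) x Dx.
by rewrite -cats1 foldr_cat => c d; split.
Qed.

Lemma rsmooth_is_derive D f x j : rsmooth D f -> D x ->
  is_derive x (delta_mx 0 j : V) f (rpartial j f x).
Proof. by move=> fs Dx; apply: DeriveDef => //; have [_] := fs [::] x Dx; exact. Qed.

Lemma is_derive_coord (i j : 'I_m) (x : V) :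
  is_derive x (delta_mx 0 i : V) (fun y : V => y ord0 j) (i == j)%:R.
Proof.
apply/is_derive_line.
rewrite (_ : (fun _ => _) = id * cst (i == j)%:R + cst (x ord0 j)); last first.
  by apply/funext => t /=; rewrite !fctE !mxE eqxx /= eq_sym.
apply: is_derive_eq; rewrite /= addr0 [(id 0) *: _]mul0r add0r.
by rewrite [_ *: _]mulr1.
Qed.

(** A class stable under partial derivatives on D: one differentiation step per constructor replaces
    a Leibniz formula for iterated derivatives. Inverses and [theta] are there for the bump
    functions. *)
Inductive smooth_expr D : (V -> R) -> Prop :=
| se_base f : rsmooth D f -> smooth_expr D f
| se_cst c : smooth_expr D (fun=> c)
| se_coord j : smooth_expr D (fun x => x ord0 j)
| se_add f g : smooth_expr D f -> smooth_expr D g ->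
    smooth_expr D (fun x => f x + g x)
| se_mul f g : smooth_expr D f -> smooth_expr D g ->
    smooth_expr D (fun x => f x * g x)
| se_inv f : smooth_expr D f -> (forall x, D x -> f x != 0) ->
    smooth_expr D (fun x => (f x)^-1)
| se_theta k f : smooth_expr D f -> smooth_expr D (fun x => theta k (f x)).

Lemma smooth_expr_continuous D f : smooth_expr D f ->
  forall x, D x -> {for x, continuous f}.
Proof.
elim=> {f} [f fD|c|j|f g _ fc _ gc|f g _ fc _ gc|f _ fc f0|k f _ fc] x Dx.
- by have [] := fD [::] x Dx.
- exact: cst_continuous.
- exact: coord_continuous.
- by apply: continuousD; [exact: fc|exact: gc].
- by apply: continuousM; [exact: fc|exact: gc].
- by apply: continuousV; [exact: f0|exact: fc].
- apply: continuous_comp; first exact: fc.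
  apply: differentiable_continuous; apply/derivable1_diffP.
  by have [] := is_derive_theta k (f x).
Qed.

Lemma smooth_expr_derive D f : smooth_expr D f -> forall j : 'I_m,
  exists2 g, smooth_expr D g &
    forall x, D x -> is_derive x (delta_mx 0 j : V) f (g x).
Proof.
move=> + j; elim=> {f} [f fD|c|k|f g fs [f' f's fd] gs [g' g's gd]
  |f g fs [f' f's fd] gs [g' g's gd]|f fs [f' f's fd] f0|k f fs [f' f's fd]].
- exists (rpartial j f); first exact/se_base/rsmooth_partial.
  by move=> x Dx; apply: rsmooth_is_derive fD Dx.
- by exists (fun=> 0); [exact: se_cst|move=> x _; exact: is_derive_cst].
- exists (fun=> (j == k)%:R); first exact: se_cst.
  by move=> x _; exact: is_derive_coord.
- exists (fun x => f' x + g' x); first exact: se_add.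
  by move=> x Dx; apply: is_deriveD; [exact: fd|exact: gd].
- exists (fun x => f x * g' x + g x * f' x).
    by apply: se_add; apply: se_mul.
  by move=> x Dx; apply: is_deriveM; [exact: fd|exact: gd].
- exists (fun x => -1 * ((f x)^-1 * (f x)^-1) * f' x).
    apply: se_mul => //; apply: se_mul; first exact: se_cst.
    by apply: se_mul; exact: se_inv.
  move=> x Dx.
  apply: (@is_derive_comp_scalar _ _ (fun t : R => t^-1)); first exact: fd.
  have := @is_deriveV R id (f x) 1 1 (f0 x Dx) (is_derive_id (f x) (1 : R)).
  by rewrite [_ *: _]mulr1 /= expr2 invfM mulN1r.
- exists (fun x => (theta k.+2 (f x) + - k%:R * theta k.+1 (f x)) * f' x).
    apply: se_mul => //; apply: se_add; first exact: se_theta.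
    by apply: se_mul; [exact: se_cst|exact: se_theta].
  move=> x Dx; rewrite mulNr.
  by apply: is_derive_comp_scalar; [exact: fd|exact: is_derive_theta].
Qed.

Lemma smooth_expr_rsmooth D f g : open D -> smooth_expr D f ->
  {in D, g =1 f} -> rsmooth D g.
Proof.
move=> oD fs gf.
(* Equality on D survives differentiation because D is open, so every iterated partial of g is again
   an expression on D. *)
have it s : exists2 h, smooth_expr D h & {in D, foldr (@rpartial R m) g s =1 h}.
  elim: s => [|j s [h hs hE]]; first by exists f.
  have [h' h's h'd] := smooth_expr_derive hs j.
  exists h' => // x; rewrite inE => Dx /=.
  have [_ <-] := h'd x Dx; apply: near_eq_derive.
  by near=> y; apply: hE; rewrite inE; near: y; exact: open_nbhs_nbhs.
move=> s x Dx; have [h hs hE] := it s.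
have nE : \near x, foldr (@rpartial R m) g s x = h x.
  by near=> y; apply: hE; rewrite inE; near: y; exact: open_nbhs_nbhs.
split.
  have ch : h @ x --> h x := smooth_expr_continuous hs Dx.
  suff : foldr (@rpartial R m) g s @ x --> foldr (@rpartial R m) g s x by [].
  rewrite hE ?inE //; apply: cvg_trans ch; apply: (@near_eq_cvg _ _ (nbhs x)).
  by near=> y; apply/esym; near: y.
move=> j; have [h' _ /(_ x Dx)[d _]] := smooth_expr_derive hs j.
apply: near_eq_derivable d.
by near=> y; apply/esym; near: y.
Unshelve. all: by end_near. Qed.

Lemma rsmooth_ext D f g : open D -> {in D, g =1 f} -> rsmooth D f ->
  rsmooth D g.
Proof. by move=> oD gf fs; apply: smooth_expr_rsmooth gf => //; exact: se_base. Qed.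

End RealSmooth.

(** * Differentiability from continuous partial derivatives, and the chain rule *)

Section ChainRule.
Variable R : realType.

(** The symmetric condition on t covers increments b of either sign, as they occur among the
    coordinates of a vector. *)
Lemma mean_value_bound (f df : R -> R) (b e : R) :
  (forall t, `|t| <= `|b| -> is_derive t (1 : R) f (df t) /\ `|df t| <= e) ->
  `|f b - f 0| <= e * `|b|.
Proof.
move=> fdf.
have cont (u v : R) : (forall t, t \in `[u, v] -> `|t| <= `|b|) ->
    {within `[u, v], continuous f}.
  move=> uv; apply: derivable_within_continuous => t /uv /fdf[[]]; by [].
have [b0|b0] := leP 0 b.
  have itb t : t \in `[0, b] -> `|t| <= `|b|.
    by rewrite in_itv /= => /andP[t0 tb]; rewrite !ger0_norm.
  have [||c /itb cb ->] := @MVT_segment R f df 0 b b0.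
  - by move=> t /subset_itv_oo_cc /itb /fdf[].
  - exact: cont.
  by rewrite subr0 normrM ler_wpM2r //; have [] := fdf c cb.
have itb t : t \in `[b, 0] -> `|t| <= `|b|.
  rewrite in_itv /= => /andP[t0 tb].
  by rewrite !ler0_norm ?lerN2 // ltW.
have [||c /itb cb] := @MVT_segment R f df b 0 (ltW b0).
- by move=> t /subset_itv_oo_cc /itb /fdf[].
- exact: cont.
rewrite distrC => ->.
by rewrite sub0r normrM normrN ler_wpM2r //; have [] := fdf c cb.
Qed.

Section Increments.
Variable m : nat.
Notation V := 'rV[R]_m.

Lemma rV_coord_le (h : V) j : `|h ord0 j| <= `|h|.
Proof.
rewrite [leRHS]/Num.Def.normr/= mx_normrE.
exact: (le_bigmax _ (fun i : 'I_1 * 'I_m => `|h i.1 i.2|) (ord0, j)).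
Qed.

Lemma rV_norm_le (h : V) (r : R) : 0 <= r -> (forall j, `|h ord0 j| <= r) ->
  `|h| <= r.
Proof.
move=> r0 hr; rewrite [leLHS]/Num.Def.normr/= mx_normrE (bigmax_le _ r0) //=.
by move=> [i j] _; rewrite (ord1 i).
Qed.

Lemma increment_le (g : V -> R) (d : 'I_m -> V -> R) (x h : V) (e : R) :
  (forall y, `|y - x| <= `|h| -> forall j,
     is_derive y (delta_mx 0 j : V) g (d j y) /\ `|d j y| <= e) ->
  `|g (x + h) - g x| <= m%:R * e * `|h|.
Proof.
move=> gd.
(* The path from x to x + h runs parallel to the axes, one coordinate at a time. In the sup norm it
   stays within distance |h| of x, and the mean value bound applies to each leg. *)
pose hk k : V := \row_i (if (i < k)%N then h ord0 i else 0).
have step k : (k <= m)%N -> `|g (x + hk k) - g x| <= k%:R * e * `|h|.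
  elim: k => [_|k IH km].
    rewrite (_ : hk 0%N = 0) ?addr0 ?subrr ?normr0 ?mul0r //.
    by apply/rowP => i; rewrite !mxE ltn0.
  pose j := Ordinal km.
  pose phi (t : R) : R := g (t *: (delta_mx 0 j : V) + (x + hk k)).
  have hkS : x + hk k.+1 = h ord0 j *: (delta_mx 0 j : V) + (x + hk k).
    rewrite addrCA; congr (_ + _); apply/rowP => i; rewrite !mxE eqxx /=.
    rewrite -val_eqE /= ltnS leq_eqVlt.
    have [ik|ik] /= := eqVneq (i : nat) k.
      rewrite ik ltnn mulr1 addr0; congr (h _ _); exact: val_inj.
    by rewrite mulr0 add0r.
  have phib : `|phi (h ord0 j) - phi 0| <= e * `|h ord0 j|.
    apply: (@mean_value_bound phi
      (fun t => d j (t *: (delta_mx 0 j : V) + (x + hk k)))) => t th.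
    have [|dt et] := gd (t *: (delta_mx 0 j : V) + (x + hk k)) _ j.
      rewrite addrA addrAC addrK; apply: rV_norm_le => // i.
      rewrite !mxE eqxx /= eq_sym -val_eqE /=.
      have [ik|ik] /= := eqVneq (k : nat) i.
        by rewrite ik ltnn mulr1 addr0 (le_trans th) // rV_coord_le.
      rewrite mulr0 add0r; case: ifP => _; first exact: rV_coord_le.
      by rewrite normr0.
    split=> //; apply/is_derive_line.
    move/is_derive_line : dt.
    congr (is_derive _ _ _ _); apply/funext => u.
    by rewrite /phi addrA -scalerDl [u *: 1]mulr1.
  have -> : k.+1%:R * e * `|h| = e * `|h| + k%:R * e * `|h|.
    by rewrite -natr1; ring.
  have e0 : 0 <= e.
    have [] := gd x _ j; first by rewrite subrr normr0.
    by move=> _; apply: le_trans.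
  rewrite hkS -(subrKA (g (x + hk k))).
  apply: (le_trans (ler_normD _ _)); rewrite lerD ?IH ?(ltnW km) //.
  move: phib; rewrite /phi scale0r add0r => /le_trans; apply.
  by rewrite ler_wpM2l // rV_coord_le.
have := step m (leqnn m); rewrite (_ : hk m = h) //.
by apply/rowP => i; rewrite !mxE ltn_ord.
Qed.

End Increments.

Lemma differentiable_of_flat (K : numFieldType) (V W : normedModType K)
    (g : V -> W) (x : V) :
  (forall e : K, 0 < e ->
     \forall h \near (0 : V), `|g (h + x) - g x| <= e * `|h|) ->
  differentiable g x.
Proof.
move=> gx.
have gE : g \o shift x = cst (g x) + \0 +o_ 0 id.
  apply/eqaddoP => e e0; near=> h.
  by rewrite !fctE /= addr0; near: h; exact: gx.
apply/diff_locallyP.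
have -> : 'd g x = \0 :> (V -> W).
  by apply: diff_unique => //; exact: cst_continuous.
by split=> //; exact: cst_continuous.
Unshelve. all: by end_near. Qed.

Lemma differentiable_of_partials0 (m : nat) (D : set 'rV[R]_m)
    (g : 'rV[R]_m -> R) (d : 'I_m -> 'rV[R]_m -> R) (x : 'rV[R]_m) :
  open D -> D x ->
  (forall y, D y -> forall j,
     is_derive y (delta_mx 0 j : 'rV[R]_m) g (d j y)) ->
  (forall j, d j y @[y --> x] --> (0 : R)) ->
  differentiable g x.
Proof.
move=> oD Dx gd d0; apply: differentiable_of_flat => e e0.
(* The m legs of the path contribute m e' in total, which is below e; the successor avoids dividing
   by zero when m = 0. *)
pose e' := e / m.+1%:R.
have e'0 : 0 < e' by rewrite divr_gt0.
have : \forall y \near x, D y /\ forall j, `|d j y| <= e'.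
  near=> y; split; first by near: y; exact: open_nbhs_nbhs.
  near: y; apply: filter_forall => j.
  by move/cvgr0Pnorm_le: (d0 j) => /(_ _ e'0).
rewrite -nbhs_nearE => /nbhs_ballP[r /= r0 br].
apply/nbhs_ballP; exists r => // h.
rewrite -ball_normE /= sub0r normrN => hr.
have inc : `|g (x + h) - g x| <= m%:R * e' * `|h|.
  apply: increment_le => y yh j.
  have [Dy dy] : D y /\ forall j, `|d j y| <= e'.
    by apply: br; rewrite -ball_normE /= distrC (le_lt_trans yh).
  by split; [exact: gd|exact: dy].
rewrite [h + x]addrC; apply: (le_trans inc).
rewrite ler_wpM2r // /e' mulrCA ler_piMr ?ltW //.
by rewrite ltr_pdivrMr // mul1r ltr_nat.
Unshelve. all: by end_near. Qed.

(** Subtracting the linear map L with the partials of f at x leaves a function whose partials tend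
    to 0 at x, which reduces the claim to the flat case. *)
Lemma rsmooth_differentiable (m : nat) (D : set 'rV[R]_m) (f : 'rV[R]_m -> R) x :
  open D -> rsmooth D f -> D x -> differentiable f x.
Proof.
move=> oD fs Dx.
pose L := \sum_(j < m) (fun y : 'rV[R]_m => rpartial j f x * y ord0 j).
have dL : differentiable L x.
  apply: differentiable_sum => j.
  by apply: differentiableM => //; exact: differentiable_coord.
have coordd (i j : 'I_m) (y : 'rV[R]_m) : is_derive y (delta_mx 0 j : 'rV[R]_m)
    (fun y : 'rV[R]_m => rpartial i f x * y ord0 i)
    (rpartial i f x * (i == j)%:R).
  apply/is_derive_line.
  rewrite (_ : (fun _ => _) = (id * cst (rpartial i f x * (i == j)%:R) +
      cst (rpartial i f x * y ord0 i))); last first.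
    by apply/funext => t /=; rewrite !fctE !mxE eqxx /= mulrDr mulrCA.
  apply: is_derive_eq; rewrite /= addr0 [(id 0) *: _]mul0r add0r.
  by rewrite [_ *: _]mulr1.
have Ld j y : is_derive y (delta_mx 0 j : 'rV[R]_m) L (rpartial j f x).
  apply: is_derive_eq (_ : \sum_i rpartial i f x * (i == j)%:R = _).
  rewrite (bigD1 j) //= eqxx mulr1 big1 ?addr0 // => i /negbTE ->.
  by rewrite mulr0.
suff dfL : differentiable (f - L : 'rV[R]_m -> R) x.
  by have := differentiableD dfL dL; rewrite subrK.
apply: (@differentiable_of_partials0 _ _ _
  (fun j y => rpartial j f y - rpartial j f x) _ oD Dx).
  move=> y Dy j; apply: is_deriveB; apply: DeriveDef => //.
  by have [_] := fs [::] y Dy; exact.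
move=> j; have [c _] := fs [:: j] x Dx.
have {}c : rpartial j f y @[y --> x] --> rpartial j f x by exact: c.
have := cvgB c (@cvg_cst _ (rpartial j f x) _ (nbhs x) _); rewrite subrr.
exact.
Qed.

(** Only the outer function has to be differentiable: F enters through the curve t -> F(t v + x), so
    derivatives of its coordinates along v suffice. *)
Lemma rsmooth_chain (m p : nat) (D : set 'rV[R]_p) (f : 'rV[R]_p -> R)
    (F : 'rV[R]_m -> 'rV[R]_p) (dF : 'I_p -> R) (x v : 'rV[R]_m) :
  open D -> rsmooth D f -> D (F x) ->
  (forall k, is_derive x v (fun y => F y ord0 k) (dF k)) ->
  is_derive x v (f \o F) (\sum_k rpartial k f (F x) * dF k).
Proof.
move=> oD fs Dx Fd; apply/is_derive_line.
pose gam (t : R) : 'rV[R]_p := F (t *: v + x).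
have gam0 : gam 0 = F x by rewrite /gam scale0r add0r.
have gd : derivable gam 0 1.
  apply/derivable_mxP => i k; rewrite (ord1 i).
  by have /is_derive_line[] := Fd k.
have gdiff : differentiable gam 0 by apply/derivable1_diffP.
have fdiff : differentiable f (gam 0).
  by rewrite gam0; exact: rsmooth_differentiable Dx.
have fgd : differentiable (f \o gam) 0 by exact: differentiable_comp.
apply: DeriveDef; first exact: diff_derivable.
transitivity ('D_1 (f \o gam) 0) => //.
rewrite deriveE // diff_comp //=.
rewrite -[X in 'd f _ X](deriveE _ gdiff) derive_mx // gam0.
have fE : 'd f (F x) =
    (fun h : 'rV[R]_p => \sum_k rpartial k f (F x) * h ord0 k) :> (_ -> _).
  apply/funext => h; rewrite [in LHS](row_sum_delta h) linear_sum /=.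
  apply: eq_bigr => k _; rewrite linearZ /= mulrC; congr (_ * _).
  by rewrite -deriveE // -gam0.
rewrite fE; apply: eq_bigr => k _; rewrite mxE; congr (_ * _).
by have /is_derive_line[_] := Fd k.
Qed.

End ChainRule.
(** * Wirtinger calculus *)

Section ComplexSmooth.
Variables (R : realType) (m : nat).
Notation V := 'rV[R]_m.
Implicit Types (D : set V) (f g : V -> R[i]) (x : V).

Lemma ReM (a b : R[i]) :
  complex.Re (a * b) = complex.Re a * complex.Re b - complex.Im a * complex.Im b.
Proof. by case: a b => [? ?] [? ?]. Qed.

Lemma ImM (a b : R[i]) :
  complex.Im (a * b) = complex.Re a * complex.Im b + complex.Im a * complex.Re b.
Proof. by case: a b => [? ?] [? ?]. Qed.

Lemma ReD (a b : R[i]) : complex.Re (a + b) = complex.Re a + complex.Re b.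
Proof. by case: a b => [? ?] [? ?]. Qed.

Lemma ImD (a b : R[i]) : complex.Im (a + b) = complex.Im a + complex.Im b.
Proof. by case: a b => [? ?] [? ?]. Qed.

Lemma Re_sum (I : Type) (s : seq I) (F : I -> R[i]) :
  complex.Re (\sum_(i <- s) F i) = \sum_(i <- s) complex.Re (F i).
Proof. by elim: s => [|i s IH]; rewrite ?big_nil // !big_cons ReD IH. Qed.

Lemma Im_sum (I : Type) (s : seq I) (F : I -> R[i]) :
  complex.Im (\sum_(i <- s) F i) = \sum_(i <- s) complex.Im (F i).
Proof. by elim: s => [|i s IH]; rewrite ?big_nil // !big_cons ImD IH. Qed.

Lemma csmooth_ext D f g : open D -> {in D, g =1 f} -> csmooth D f -> csmooth D g.
Proof.
by move=> oD gf [fr fi]; split; [apply: rsmooth_ext fr|apply: rsmooth_ext fi] => //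
  x Dx; rewrite gf.
Qed.

Lemma csmooth_subset D D' f : D' `<=` D -> csmooth D f -> csmooth D' f.
Proof. by move=> DD' [fr fi]; split; exact: rsmooth_subset DD' _. Qed.

Lemma csmooth_cst D (c : R[i]) : open D -> csmooth D (fun=> c).
Proof. by move=> oD; split; apply: smooth_expr_rsmooth (se_cst _ _) _. Qed.

Lemma csmoothD D f g : open D -> csmooth D f -> csmooth D g ->
  csmooth D (fun x => f x + g x).
Proof.
move=> oD [fr fi] [gr gi]; split.
  apply: (smooth_expr_rsmooth oD (se_add (se_base fr) (se_base gr))) => x _.
  exact: ReD.
apply: (smooth_expr_rsmooth oD (se_add (se_base fi) (se_base gi))) => x _.
exact: ImD.
Qed.

Lemma csmoothM D f g : open D -> csmooth D f -> csmooth D g ->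
  csmooth D (fun x => f x * g x).
Proof.
move=> oD [fr fi] [gr gi]; split.
  apply: (smooth_expr_rsmooth oD (se_add (se_mul (se_base fr) (se_base gr))
    (se_mul (se_cst D (-1)) (se_mul (se_base fi) (se_base gi))))) => x _.
  by rewrite ReM mulN1r.
apply: (smooth_expr_rsmooth oD (se_add (se_mul (se_base fr) (se_base gi))
   (se_mul (se_base fi) (se_base gr)))) => x _.
exact: ImM.
Qed.

Lemma csmooth_conj D f : open D -> csmooth D f ->
  csmooth D (fun x => ((f x)^*)%C).
Proof.
move=> oD [fr fi]; split.
  by apply: (smooth_expr_rsmooth oD (se_base fr)) => x _; case: (f x).
apply: (smooth_expr_rsmooth oD (se_mul (se_cst _ (-1)) (se_base fi))) => x _.
by rewrite mulN1r; case: (f x).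
Qed.

Lemma csmooth_sum D (I : Type) (s : seq I) (F : I -> V -> R[i]) : open D ->
  (forall i, csmooth D (F i)) -> csmooth D (fun x => \sum_(i <- s) F i x).
Proof.
move=> oD Fs; elim: s => [|i s IH].
  by apply: csmooth_ext (csmooth_cst 0 oD) => // x _; rewrite big_nil.
by apply: csmooth_ext (csmoothD oD (Fs i) IH) => // x _; rewrite big_cons.
Qed.

(** Unlike the bare value [cpartial], this carries the differentiability of both parts, which the
    sum and product rules require. *)
Definition is_cderive j x f (d : R[i]) : Prop :=
  is_derive x (delta_mx 0 j : V) (fun y => complex.Re (f y)) (complex.Re d) /\
  is_derive x (delta_mx 0 j : V) (fun y => complex.Im (f y)) (complex.Im d).

Lemma is_cderive_val j x f d : is_cderive j x f d -> cpartial j f x = d.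
Proof. by case: d => a b [[_ /= da] [_ /= db]]; rewrite /cpartial /rpartial da db. Qed.

Lemma csmooth_is_cderive D f j x : csmooth D f -> D x ->
  is_cderive j x f (cpartial j f x).
Proof.
by move=> [fr fi] Dx; split; [apply: rsmooth_is_derive fr Dx
  |apply: rsmooth_is_derive fi Dx].
Qed.

Lemma is_cderive_cst j x (c : R[i]) : is_cderive j x (fun=> c) 0.
Proof. by split; exact: is_derive_cst. Qed.

Lemma is_cderiveD j x f g df dg : is_cderive j x f df -> is_cderive j x g dg ->
  is_cderive j x (fun y => f y + g y) (df + dg).
Proof.
move=> [fr fi] [gr gi]; split; rewrite ?ReD ?ImD.
  by under eq_fun do rewrite ReD; apply: is_deriveD.
by under eq_fun do rewrite ImD; apply: is_deriveD.
Qed.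

Lemma is_cderiveM j x f g df dg : is_cderive j x f df -> is_cderive j x g dg ->
  is_cderive j x (fun y => f y * g y) (f x * dg + g x * df).
Proof.
move=> [fr fi] [gr gi]; split.
  under eq_fun do rewrite ReM.
  apply: (is_derive_eq (is_deriveB (is_deriveM fr gr) (is_deriveM fi gi))).
  by rewrite ReD !ReM /GRing.scale /=; ring.
under eq_fun do rewrite ImM.
apply: (is_derive_eq (is_deriveD (is_deriveM fr gi) (is_deriveM fi gr))).
by rewrite ImD !ImM /GRing.scale /=; ring.
Qed.

Lemma cpartial_near D f g j x : open D -> D x -> {in D, f =1 g} ->
  cpartial j f x = cpartial j g x.
Proof.
move=> oD Dx fg; congr (_ +i* _)%C; apply: near_eq_derive;
  by near=> y; rewrite fg // inE; near: y; exact: open_nbhs_nbhs.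
Unshelve. all: by end_near. Qed.

Lemma csmooth_cpartial D f j : csmooth D f -> csmooth D (cpartial j f).
Proof. by move=> [fr fi]; split; exact: rsmooth_partial. Qed.

End ComplexSmooth.

Section WirtingerCalculus.
Variables (R : realType) (n : nat).
Notation V := 'rV[R]_(n + n).
Implicit Types (D : set V) (f g : V -> R[i]) (x : V) (j : 'I_(n + n)).

Lemma split_lshift (k : 'I_n) : fintype.split (lshift n k) = inl k :> 'I_n + 'I_n.
Proof. exact: (unsplitK (inl k)). Qed.

Lemma split_rshift (k : 'I_n) : fintype.split (rshift n k) = inr k :> 'I_n + 'I_n.
Proof. exact: (unsplitK (inr k)). Qed.

Lemma czcoord_hol k x : czcoord (lshift n k) x = zcoord k x.
Proof. by rewrite /czcoord split_lshift. Qed.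

Lemma czcoord_anti k x : czcoord (rshift n k) x = ((zcoord k x)^*)%C.
Proof. by rewrite /czcoord split_rshift. Qed.

(** The constant matrix expressing the frame (Z_k, Zbar_k) in the real frame (d/dx^k, d/dy^k);
    through it the rules for [cpartial] pass to [wirtinger] by linearity. *)
Definition wcoef j (i : 'I_(n + n)) : R[i] :=
  match fintype.split j, fintype.split i with
  | inl k, inl l => (k == l)%:R / 2
  | inl k, inr l => - 'i%C * (k == l)%:R / 2
  | inr k, inl l => (k == l)%:R / 2
  | inr k, inr l => 'i%C * (k == l)%:R / 2
  end.

Lemma wirtingerE j f x : wirtinger j f x = \sum_i wcoef j i * cpartial i f x.
Proof.
have split1 (F : 'I_n -> R[i]) (c : R[i]) k :
    \sum_i c * (k == i)%:R / 2 * F i = c * F k / 2.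
  rewrite (bigD1 k) //= eqxx mulr1 big1 ?addr0 => [|i]; first by rewrite mulrAC.
  by rewrite eq_sym => /negbTE ->; rewrite mulr0 !mul0r.
have wl k : wirtinger (lshift n k) f x =
   (cpartial (lshift n k) f x - 'i%C * cpartial (rshift n k) f x) / 2.
  by rewrite /wirtinger split_lshift.
have wr k : wirtinger (rshift n k) f x =
   (cpartial (lshift n k) f x + 'i%C * cpartial (rshift n k) f x) / 2.
  by rewrite /wirtinger split_rshift.
rewrite -[j]splitK big_split_ord /=; case: (fintype.split j) => k /=.
  rewrite wl mulrBl; congr (_ + _).
    rewrite -[X in X / 2]mul1r -(split1 (fun i => cpartial (lshift n i) f x)).
    by apply: eq_bigr => i _; rewrite /wcoef !split_lshift mul1r.
  rewrite -!mulNr -(split1 (fun i => cpartial (rshift n i) f x)).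
  by apply: eq_bigr => i _; rewrite /wcoef split_lshift split_rshift.
rewrite wr mulrDl; congr (_ + _).
  rewrite -[X in X / 2]mul1r -(split1 (fun i => cpartial (lshift n i) f x)).
  by apply: eq_bigr => i _; rewrite /wcoef split_lshift split_rshift mul1r.
rewrite -(split1 (fun i => cpartial (rshift n i) f x)).
by apply: eq_bigr => i _; rewrite /wcoef !split_rshift.
Qed.

Lemma csmooth_wirtinger D f j : open D -> csmooth D f ->
  csmooth D (wirtinger j f).
Proof.
move=> oD fs.
rewrite (_ : wirtinger j f = (fun x => \sum_i wcoef j i * cpartial i f x)); last first.
  by apply/funext => x; exact: wirtingerE.
apply: (@csmooth_sum _ _ D _ _ (fun i x => wcoef j i * cpartial i f x) oD) => i.
apply: (@csmoothM _ _ D (fun=> wcoef j i) (cpartial i f) oD).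
  exact: (csmooth_cst _ oD).
exact: (csmooth_cpartial _ fs).
Qed.

Lemma wirtinger_near D f g j x : open D -> D x -> {in D, f =1 g} ->
  wirtinger j f x = wirtinger j g x.
Proof.
by move=> oD Dx fg; rewrite !wirtingerE; apply: eq_bigr => i _;
  rewrite (cpartial_near _ oD Dx fg).
Qed.

Lemma wirtinger_cst (c : R[i]) j x : wirtinger j (fun=> c) x = 0.
Proof.
rewrite wirtingerE big1 // => i _.
by rewrite (is_cderive_val (is_cderive_cst _ _ _)) mulr0.
Qed.

Lemma wirtingerD D f g j x : csmooth D f -> csmooth D g -> D x ->
  wirtinger j (fun y => f y + g y) x = wirtinger j f x + wirtinger j g x.
Proof.
move=> fs gs Dx; rewrite !wirtingerE -big_split; apply: eq_bigr => i _.
have fd := csmooth_is_cderive i fs Dx; have gd := csmooth_is_cderive i gs Dx.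
by rewrite (is_cderive_val (is_cderiveD fd gd)) mulrDr.
Qed.

Lemma wirtingerM D f g j x : csmooth D f -> csmooth D g -> D x ->
  wirtinger j (fun y => f y * g y) x =
  f x * wirtinger j g x + g x * wirtinger j f x.
Proof.
move=> fs gs Dx; rewrite !wirtingerE !mulr_sumr -big_split.
apply: eq_bigr => i _.
have fd := csmooth_is_cderive i fs Dx; have gd := csmooth_is_cderive i gs Dx.
by rewrite (is_cderive_val (is_cderiveM fd gd)) /=; ring.
Qed.

Lemma wirtinger_czcoord i j x : wirtinger i (@czcoord R n j) x = (i == j)%:R.
Proof.
have C0 : (0 +i* 0)%C = 0 :> R[i] by [].
have i2 : 'i%C * 'i%C = -1 :> R[i] by rewrite -expr2 sqr_i.
have half (z : R[i]) : (z + z) / 2 = z.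
  by rewrite -mulr2n -[z *+ 2]mulr_natr mulfK // pnatr_eq0.
have ii (z : R[i]) : 'i%C * ('i%C * z) = - z by rewrite mulrA i2 mulN1r.
have rC (b : bool) : (b%:R +i* 0)%C = b%:R :> R[i] by case: b.
have iC (b : bool) : (0 +i* b%:R)%C = 'i%C * b%:R :> R[i].
  by case: b; rewrite ?mulr1 ?mulr0.
have iCN (b : bool) : (0 +i* - b%:R)%C = - 'i%C * b%:R :> R[i].
  case: b; rewrite ?mulr1 ?mulr0 ?oppr0 //.
  by apply/eqP; rewrite eq_complex /= oppr0 !eqxx.
have cz k l : cpartial k (@czcoord R n (lshift n l)) x =
    ((k == lshift n l)%:R +i* (k == rshift n l)%:R)%C.
  rewrite /czcoord split_lshift.
  by apply: is_cderive_val; split; exact: is_derive_coord.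
have czb k l : cpartial k (@czcoord R n (rshift n l)) x =
    ((k == lshift n l)%:R +i* - (k == rshift n l)%:R)%C.
  rewrite /czcoord split_rshift.
  apply: is_cderive_val; split; first exact: is_derive_coord.
  by apply: is_deriveN; exact: is_derive_coord.
rewrite /wirtinger -(splitK i) -(splitK j).
case: (fintype.split i) => k; case: (fintype.split j) => l;
  rewrite /= ?split_lshift ?split_rshift ?cz ?czb
    ?eq_lshift ?eq_rshift ?eq_lrshift ?eq_rlshift ?oppr0 ?rC ?iC ?iCN
    ?mulNr ?mulrN ?ii ?opprK ?addrN ?addNr ?mul0r ?half //.
Qed.

(** The real chain rule with each pair dx^k, dy^k regrouped into dz^k, dzbar^k. F need not be
    holomorphic, hence the sum over both kinds of coordinates. *)
Lemma cpartial_chain (D D' : set V) f (F : V -> V) (i : 'I_(n + n)) x :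
  open D' -> csmooth D' f -> D' (F x) -> D x ->
  (forall k : 'I_n, csmooth D (fun y => zcoord k (F y))) ->
  cpartial i (f \o F) x =
  \sum_j cpartial i (@czcoord R n j \o F) x * wirtinger j f (F x).
Proof.
move=> oD' [fr fi] DFx Dx Fs.
pose dF (j : 'I_(n + n)) : R := rpartial i (fun y => F y ord0 j) x.
have Fd j : is_derive x (delta_mx 0 i : V) (fun y => F y ord0 j) (dF j).
  rewrite /dF -[j]splitK; case: (fintype.split j) => k /=.
    by have [Fr _] := Fs k; exact: rsmooth_is_derive Fr Dx.
  by have [_ Fi] := Fs k; exact: rsmooth_is_derive Fi Dx.
have -> : cpartial i (f \o F) x = \sum_k cpartial k f (F x) * (dF k)%:C%C.
  have [_ re] := rsmooth_chain oD' fr DFx Fd.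
  have [_ im] := rsmooth_chain oD' fi DFx Fd.
  rewrite /cpartial /rpartial re im.
  apply/eqP; rewrite eq_complex /=.
  rewrite Re_sum Im_sum.
  by apply/andP; split; apply/eqP/eq_bigr => k _;
    rewrite ?ReM ?ImM /= ?mulr0 ?subr0 ?add0r.
have cz k : cpartial i (@czcoord R n (lshift n k) \o F) x =
    (dF (lshift n k) +i* dF (rshift n k))%C.
  apply: is_cderive_val; rewrite /comp /czcoord split_lshift.
  by split; exact: Fd.
have czb k : cpartial i (@czcoord R n (rshift n k) \o F) x =
    (dF (lshift n k) +i* - dF (rshift n k))%C.
  apply: is_cderive_val; rewrite /comp /czcoord split_rshift.
  by split; [exact: Fd|apply: is_deriveN; exact: Fd].
rewrite !big_split_ord /= -!big_split /=; apply: eq_bigr => k _.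
rewrite cz czb /wirtinger split_lshift split_rshift.
rewrite [(dF _ +i* dF _)%C]complexE [(dF _ +i* - dF _)%C]complexE /= rmorphN /=.
have i2 : 'i%C ^+ 2 = -1 :> R[i] by rewrite sqr_i.
set a := (dF (lshift n k))%:C%C; set b := (dF (rshift n k))%:C%C.
set p := cpartial _ f _; set q := cpartial _ f _.
(* For [field] the imaginary unit is an atom, so its square is kept visible. *)
transitivity (p * a - 'i%C ^+ 2 * (q * b)); first by rewrite i2; ring.
by field.
Qed.

Lemma wirtinger_chain (D D' : set V) f (F : V -> V) (i : 'I_(n + n)) x :
  open D' -> csmooth D' f -> D' (F x) -> D x ->
  (forall k : 'I_n, csmooth D (fun y => zcoord k (F y))) ->
  wirtinger i (f \o F) x =
  \sum_j wirtinger i (@czcoord R n j \o F) x * wirtinger j f (F x).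
Proof.
move=> oD' fs DFx Dx Fs; rewrite wirtingerE.
under eq_bigr do rewrite (cpartial_chain _ oD' fs DFx Dx Fs) mulr_sumr.
rewrite exchange_big /=; apply: eq_bigr => j _.
by rewrite [wirtinger i _ x]wirtingerE mulr_suml; apply: eq_bigr => k _; rewrite mulrA.
Qed.

End WirtingerCalculus.
(** * Functions on complex manifolds *)

Section ManifoldCalculus.
Variables (R : realType) (n : nat) (M : complexManifold R n).
Notation chartM := (chart R n M).
Implicit Types (c : chartM) (W : set M) (f g : M -> R[i]) (p : M).

(** The image of W is, inside the open image of the chart, the preimage of W under the continuous
    inverse [psi c]. *)
Lemma open_phi c W : open W -> W `<=` dom c -> open (phi c @` W).
Proof.
move=> oW Wc; rewrite openE => _ [p Wp <-].
have dp := Wc p Wp.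
have n1 : nbhs (phi c p) (phi c @` dom c).
  by apply: open_nbhs_nbhs; split; [exact: img_open|exists p].
have n2 : nbhs (phi c p) (psi c @^-1` W).
  have /psi_cont : (phi c @` dom c) (phi c p) by exists p.
  by apply; rewrite phiK //; apply: open_nbhs_nbhs.
apply: filterS (filterI n1 n2) => _ [[q dq <-]] /=; rewrite phiK // => Wq.
by exists q.
Qed.

Lemma smooth_on_subset W W' f : W' `<=` W -> smooth_on W f -> smooth_on W' f.
Proof.
move=> WW' fs c ac; apply: csmooth_subset (fs c ac) => _ [p [Wp dp] <-].
by exists p => //; split => //; exact: WW'.
Qed.

Lemma open_phiI c W : open W -> open (phi c @` (W `&` dom c)).
Proof.
by move=> oW; apply: open_phi; [apply: openI => //; exact: dom_open|move=> ? []].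
Qed.

Lemma smooth_on_ext W f g : open W -> (forall p, W p -> g p = f p) ->
  smooth_on W f -> smooth_on W g.
Proof.
move=> oW gf fs c ac; apply: csmooth_ext (fs c ac); first exact: open_phiI.
by move=> x; rewrite inE => -[p [Wp dp] <-] /=; rewrite phiK // gf.
Qed.

Lemma smooth_on_cst W (a : R[i]) : open W -> smooth_on W (fun=> a).
Proof. by move=> oW c ac; apply: csmooth_cst; exact: open_phiI. Qed.

Lemma smooth_onD W f g : open W -> smooth_on W f -> smooth_on W g ->
  smooth_on W (fun p => f p + g p).
Proof.
by move=> oW fs gs c ac; apply: csmoothD (fs c ac) (gs c ac); exact: open_phiI.
Qed.

Lemma smooth_onM W f g : open W -> smooth_on W f -> smooth_on W g ->
  smooth_on W (fun p => f p * g p).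
Proof.
by move=> oW fs gs c ac; apply: csmoothM (fs c ac) (gs c ac); exact: open_phiI.
Qed.

Lemma smooth_on_sum W (I : Type) (s : seq I) (F : I -> M -> R[i]) : open W ->
  (forall i, smooth_on W (F i)) -> smooth_on W (fun p => \sum_(i <- s) F i p).
Proof.
move=> oW Fs c ac.
apply: (@csmooth_sum _ _ _ _ _ (fun i => F i \o psi c)); first exact: open_phiI.
by move=> i; exact: Fs.
Qed.

Lemma smooth_on_local W f :
  (forall p, W p -> exists W', [/\ open W', W' p & smooth_on W' f]) ->
  smooth_on W f.
Proof.
move=> fs c ac; split=> s _ [p [Wp dp] <-];
  have [W' [oW' W'p fW']] := fs p Wp; have [fr fi] := fW' c ac;
  by [apply: fr; exists p|apply: fi; exists p].
Qed.

Lemma smooth_coord c j : atlas c -> smooth_on (dom c) (coord c j).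
Proof.
move=> ac c' ac'; have [_ hol] := atlas_compat ac ac'.
have oD : open (phi c' @` (dom c `&` dom c')).
  by apply: open_phi; [apply: openI; exact: dom_open|move=> ? []].
rewrite -(splitK j); case: (fintype.split j) => k /=; have [zs _] := hol k.
  by apply: csmooth_ext oD _ zs => x _; exact: czcoord_hol.
by apply: csmooth_ext oD _ (csmooth_conj oD zs) => x _; exact: czcoord_anti.
Qed.

(** Smoothness in one fixed chart: iterated derivatives [pd c] are taken in that chart, and this
    weaker notion is directly preserved by them. *)
Definition chart_smooth c W f := csmooth (phi c @` W) (f \o psi c).

Lemma smooth_on_chart c W f : atlas c -> W `<=` dom c -> smooth_on W f ->
  chart_smooth c W f.
Proof. by move=> ac Wc /(_ c ac); rewrite (setIidl Wc). Qed.

Lemma pd_near c W f g j p : open W -> W `<=` dom c -> W p ->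
  (forall q, W q -> f q = g q) -> pd c j f p = pd c j g p.
Proof.
move=> oW Wc Wp fg; apply: (wirtinger_near _ (open_phi oW Wc)); first by exists p.
by move=> x; rewrite inE => -[q Wq <-] /=; rewrite phiK ?fg //; exact: Wc.
Qed.

Lemma chart_smooth_pd c W f j : open W -> W `<=` dom c -> chart_smooth c W f ->
  chart_smooth c W (pd c j f).
Proof.
move=> oW Wc fs; have oD := open_phi oW Wc.
apply: csmooth_ext oD _ (csmooth_wirtinger j oD fs) => x.
by rewrite inE => -[q Wq <-] /=; rewrite /pd phiK //; exact: Wc.
Qed.

Lemma pd_cst c j (a : R[i]) p : pd c j (fun=> a) p = 0.
Proof. exact: wirtinger_cst. Qed.

Lemma pdD c W f g j p : chart_smooth c W f -> chart_smooth c W g -> W p ->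
  pd c j (fun q => f q + g q) p = pd c j f p + pd c j g p.
Proof. by move=> fs gs Wp; apply: wirtingerD fs gs _; exists p. Qed.

Lemma pdM c W f g j p : chart_smooth c W f -> chart_smooth c W g -> W p ->
  W `<=` dom c ->
  pd c j (fun q => f q * g q) p = f p * pd c j g p + g p * pd c j f p.
Proof.
move=> fs gs Wp Wc; rewrite /pd.
rewrite (_ : _ \o psi c = (fun x => (f \o psi c) x * (g \o psi c) x)) //.
rewrite (wirtingerM _ fs gs) /=; last by exists p.
by rewrite phiK //; exact: Wc.
Qed.

Lemma pd_sum c W (I : Type) (s : seq I) (F : I -> M -> R[i]) j p :
  open W -> W `<=` dom c -> (forall i, chart_smooth c W (F i)) -> W p ->
  pd c j (fun q => \sum_(i <- s) F i q) p = \sum_(i <- s) pd c j (F i) p.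
Proof.
move=> oW Wc Fs Wp; elim: s => [|i s IH].
  rewrite big_nil (pd_near _ oW Wc Wp (g := fun=> 0)) ?pd_cst // => q _.
  by rewrite big_nil.
rewrite big_cons -IH.
transitivity (pd c j (fun q => F i q + \sum_(k <- s) F k q) p).
  by apply: (pd_near _ oW Wc Wp) => q _; rewrite big_cons.
apply: pdD (Fs i) _ Wp.
exact: (@csmooth_sum _ _ _ _ _ (fun i => F i \o psi c) (open_phi oW Wc)).
Qed.

Lemma pd_coord c i j p : dom c p -> pd c i (coord c j) p = (i == j)%:R.
Proof.
move=> dp; rewrite -(wirtinger_czcoord i j (phi c p)).
apply: (wirtinger_near _ (@img_open _ _ _ c)); first by exists p.
by move=> x; rewrite inE => -[q dq <-] /=; rewrite /coord phiK.
Qed.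

Lemma pd_chain c c' W f i p : atlas c -> atlas c' -> open W -> smooth_on W f ->
  W p -> dom c p -> dom c' p ->
  pd c i f p = \sum_j pd c i (coord c' j) p * pd c' j f p.
Proof.
move=> ac ac' oW fs Wp dp dp'.
pose D' := phi c' @` (W `&` dom c'); pose D := phi c @` (dom c `&` dom c').
have oD' : open D' by exact: open_phiI.
have [hol _] := atlas_compat ac ac'.
have FE : (phi c' \o psi c) (phi c p) = phi c' p by rewrite /= phiK.
have := @wirtinger_chain _ _ D D' (f \o psi c') (phi c' \o psi c) i (phi c p)
  oD' (fs c' ac').
rewrite FE => H; rewrite -[RHS]H.
- pose W' := W `&` (dom c `&` dom c').
  have oW' : open W' by do 2! (apply: openI => //); exact: dom_open.
  have W'c : W' `<=` dom c by move=> ? [_ []].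
  apply: (wirtinger_near _ (open_phi oW' W'c)); first by exists p.
  by move=> x; rewrite inE => -[q [Wq [dq dq']] <-] /=; rewrite !phiK.
- by exists p.
- by exists p.
- by move=> k; have [] := hol k.
Qed.

Lemma differential_change c c' W f p : atlas c -> atlas c' -> open W ->
  smooth_on W f -> W p -> dom c p -> dom c' p ->
  differential f c p = differential f c' p *m (jacobian c c' p)^T.
Proof.
move=> ac ac' oW fs Wp dp dp'; apply/rowP => i; rewrite !mxE.
rewrite (pd_chain i ac ac' oW fs Wp dp dp'); apply: eq_bigr => j _.
by rewrite mulrC [in RHS]mxE mxE [in RHS]mxE.
Qed.

(** [vact] is evaluated in a chart picked by choice; the transformation law at p makes the choice
    irrelevant. X is a bare family of components so that Hamiltonian fields are covered too. *)
Lemma vact_chart (X : chartM -> M -> 'rV[R[i]]_(n + n)) c W f p :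
  (forall c', atlas c' -> dom c' p -> X c' p = X c p *m jacobian c c' p) ->
  atlas c -> dom c p -> open W -> smooth_on W f -> W p ->
  vact X f p = \sum_j X c p ord0 j * pd c j f p.
Proof.
move=> Xc ac dp oW fs Wp; rewrite /vact /chart_at; case: cid => c' /= [ac' dp'].
rewrite (Xc c' ac' dp').
under eq_bigr do rewrite mxE mulr_suml.
rewrite exchange_big /=; apply: eq_bigr => j _.
rewrite (pd_chain j ac ac' oW fs Wp dp dp') mulr_sumr.
by apply: eq_bigr => k _; rewrite mxE mulrA.
Qed.

Lemma vact_cst (X : chartM -> M -> 'rV[R[i]]_(n + n)) (a : R[i]) p :
  vact X (fun=> a) p = 0.
Proof. by apply: big1 => j _; rewrite pd_cst mulr0. Qed.

Lemma vact_near (X : chartM -> M -> 'rV[R[i]]_(n + n)) W f g p :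
  open W -> W p -> (forall q, W q -> f q = g q) -> vact X f p = vact X g p.
Proof.
move=> oW Wp fg; apply: eq_bigr => j _; congr (_ * _).
have [ac dp] := projT2 (cid (atlas_cover p)); rewrite -/(chart_at p) in ac dp *.
apply: (@pd_near _ (W `&` dom (chart_at p))).
- by apply: openI => //; exact: dom_open.
- by move=> ? [].
- by [].
- by move=> q [Wq _]; exact: fg.
Qed.

End ManifoldCalculus.

(** * Bump functions and extension of local functions *)

Section SmoothStep.
Variable R : realType.

(** The usual quotient rising from 0 at t = 0 to 1 at t = 1, spelled with the constructors of
    [smooth_expr]. *)
Definition smooth_step (t : R) : R :=
  theta 0 t * (theta 0 t + theta 0 (1 + -1 * t))^-1.

Lemma smooth_step_le0 (t : R) : t <= 0 -> smooth_step t = 0.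
Proof. by move=> t0; rewrite /smooth_step theta_le0 // mul0r. Qed.

Lemma smooth_step_den_neq0 (t : R) : theta 0 t + theta 0 (1 + -1 * t) != 0.
Proof.
rewrite gt_eqF // mulN1r; have [t0|t0] := ltP 0 t.
  by rewrite ltr_wpDr ?theta_ge0 ?theta_gt0.
by rewrite ltr_wpDl ?theta_ge0 ?theta_gt0 //; lra.
Qed.

Lemma smooth_step_ge1 (t : R) : 1 <= t -> smooth_step t = 1.
Proof.
move=> t1; have := smooth_step_den_neq0 t; rewrite /smooth_step.
rewrite (@theta_le0 R 0 (1 + -1 * t)) ?addr0; last by lra.
exact: divff.
Qed.

Variable m : nat.
Notation V := 'rV[R]_m.

(** A product over coordinates, matching the sup norm. The argument 2 - ((x_j - x0_j)/r)^2 is at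
    least 1 within distance r and negative beyond 2r; squaring avoids the non-smooth absolute
    value. *)
Definition box_bump (x0 : V) (r : R) (x : V) : R :=
  \prod_j smooth_step (2 + -1 * (((x ord0 j + - x0 ord0 j) * r^-1) *
                                 ((x ord0 j + - x0 ord0 j) * r^-1))).

Lemma box_bump1 x0 r x : 0 < r -> `|x - x0| <= r -> box_bump x0 r x = 1.
Proof.
move=> r0 xr; apply: big1 => j _; apply: smooth_step_ge1.
have jr : `|(x - x0) ord0 j| <= r by exact: le_trans (rV_coord_le _ _) xr.
have : `|(x ord0 j + - x0 ord0 j) * r^-1| <= 1.
  by rewrite normrM normfV (gtr0_norm r0) ler_pdivrMr // mul1r; rewrite !mxE in jr.
by rewrite ler_norml => /andP[]; nra.
Qed.

Lemma box_bump0 x0 r x : 0 < r -> 2 * r < `|x - x0| -> box_bump x0 r x = 0.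
Proof.
move=> r0 xr; have [j jr] : exists j, 2 * r < `|(x - x0) ord0 j|.
  apply: contrapT => /forallNP H; move: xr; apply/negP; rewrite -leNgt.
  apply: rV_norm_le => [|j]; first by rewrite mulr_ge0 // ltW.
  by rewrite leNgt; apply/negP/H.
rewrite /box_bump (bigD1 j) //= smooth_step_le0 ?mul0r //.
have : 2 < `|(x ord0 j + - x0 ord0 j) * r^-1|.
  by rewrite normrM normfV (gtr0_norm r0) ltr_pdivlMr //; rewrite !mxE in jr.
by rewrite lter_normr => /orP[]; nra.
Qed.

Lemma smooth_expr_step p (D : set 'rV[R]_p) t : smooth_expr D t ->
  smooth_expr D (fun x => smooth_step (t x)).
Proof.
move=> ts; apply: se_mul; first exact: se_theta.
apply: se_inv => [|x _]; last exact: smooth_step_den_neq0.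
apply: se_add; apply: se_theta => //; apply: se_add; first exact: se_cst.
by apply: se_mul => //; exact: se_cst.
Qed.

Lemma smooth_expr_box_bump p (D : set 'rV[R]_p) (F : 'rV[R]_p -> V) x0 r :
  (forall j, smooth_expr D (fun x => F x ord0 j)) ->
  smooth_expr D (fun x => box_bump x0 r (F x)).
Proof.
move=> Fs; rewrite /box_bump; elim: (index_enum _) => [|j s IH].
  by under eq_fun do rewrite big_nil; exact: se_cst.
under eq_fun do rewrite big_cons; apply: se_mul => //.
apply: smooth_expr_step; apply: se_add; first exact: se_cst.
apply: se_mul; first exact: se_cst.
by apply: se_mul; apply: se_mul; try exact: se_cst;
  apply: se_add => //; exact: se_cst.
Qed.

End SmoothStep.

Section Cutoff.
Variables (R : realType) (n : nat) (M : complexManifold R n).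
Notation chartM := (chart R n M).
Implicit Types (c : chartM) (W : set M) (f g : M -> R[i]) (p : M).

Lemma smooth_bump_chart c x0 r : atlas c ->
  smooth_on (dom c) (fun q => (box_bump x0 r (phi c q))%:C%C).
Proof.
move=> ac c' ac'; have [_ hol] := atlas_compat ac ac'.
have oD : open (phi c' @` (dom c `&` dom c')).
  by apply: open_phi; [apply: openI; exact: dom_open|move=> ? []].
split; last exact: (smooth_expr_rsmooth oD (se_cst _ 0)).
apply: (smooth_expr_rsmooth oD (@smooth_expr_box_bump _ _ _ _
  (phi c \o psi c') x0 r _)) => // j.
rewrite -(splitK j); case: (fintype.split j) => k /=;
  have [[zr zi] _] := hol k; [exact: se_base zr|exact: se_base zi].
Qed.

Lemma open_phi_preimage c (A : set 'rV[R]_(n + n)) : open A ->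
  open (dom c `&` phi c @^-1` A).
Proof.
move=> oA; rewrite openE => q [dq Aq]; apply: filterI.
  by apply: open_nbhs_nbhs; split => //; exact: dom_open.
by apply: (phi_cont dq); exact: open_nbhs_nbhs.
Qed.

(** A closed box is compact, so is its image in M, and the Hausdorff property makes that image
    closed. Extension by zero is smooth because the complement is open. *)
Lemma compact_in_chart c (x0 : 'rV[R]_(n + n)) (r : R) : 0 < r ->
  [set x | `|x - x0| <= r] `<=` phi c @` dom c ->
  closed (psi c @` [set x | `|x - x0| <= r]).
Proof.
move=> r0 sub; apply: compact_closed; first exact: cm_hausdorff.
apply: continuous_compact.
  by apply: continuous_in_subspaceT => x; rewrite inE => /sub; exact: psi_cont.
apply: bounded_closed_compact.
  exists (r + `|x0|); split; first exact: num_real.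
  move=> y ry x /= xr; rewrite -(subrK x0 x) (le_trans (ler_normD _ _)) //.
  by rewrite (le_trans _ (ltW ry)) // lerD2r.
rewrite (_ : mkset _ = closed_ball x0 r); first exact: closed_ball_closed.
by rewrite closed_ballE //; apply/funext => x; rewrite /closed_ball_ /= distrC.
Qed.

(** f is multiplied by a bump function and extended by zero. W, where the bump equals 1, is fixed
    before f, so several functions can be extended with the same W. *)
Lemma extension c p : atlas c -> dom c p ->
  exists W, [/\ open W, W p, W `<=` dom c &
    forall f, smooth_on (dom c) f ->
      exists2 g, smooth g & forall q, W q -> g q = f q].
Proof.
move=> ac dp; set x0 := phi c p.
have : nbhs x0 (phi c @` dom c).
  by apply: open_nbhs_nbhs; split; [exact: img_open|exists p].
(* With this r the box of radius 2r, outside of which the bump vanishes, lies in the ball of radius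
   e. *)
move=> /nbhs_ballP[e /= e0 be]; pose r := e / 3.
have r0 : 0 < r by rewrite divr_gt0.
have sub : [set x | `|x - x0| <= 2 * r] `<=` phi c @` dom c.
  move=> x /= xr; apply: be; rewrite -ball_normE /= distrC (le_lt_trans xr) //.
  by rewrite /r; lra.
pose F := psi c @` [set x | `|x - x0| <= 2 * r].
have cF : closed F by apply: compact_in_chart => //; rewrite mulr_gt0.
have Fc : F `<=` dom c.
  by move=> _ [x xr <-]; have [q dq <-] := sub x xr; rewrite phiK.
exists (dom c `&` phi c @^-1` ball x0 r); split.
- by apply: open_phi_preimage; exact: ball_open.
- by split => //; exact: ballxx.
- by move=> ? [].
move=> f fs.
pose g q : R[i] :=
  if `[< dom c q >] then (box_bump x0 r (phi c q))%:C%C * f q else 0.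
have gin q : dom c q -> g q = (box_bump x0 r (phi c q))%:C%C * f q.
  by move=> dq; rewrite /g asboolT.
have gout q : (~` F) q -> g q = 0.
  move=> Fq; rewrite /g; case: asboolP => // dq.
  rewrite box_bump0 ?mul0r // ltNge; apply/negP => le; apply: Fq.
  by exists (phi c q) => //; exact: phiK.
exists g.
  (* M is covered by two open sets: [dom c], where g is a product of smooth functions, and the
     complement of F, where g is zero. *)
  apply: smooth_on_local => q _; have [dq|dq] := pselect (dom c q).
    exists (dom c); split; [exact: dom_open|exact: dq|].
    apply: (smooth_on_ext (@dom_open _ _ _ c) gin).
    exact: (smooth_onM (@dom_open _ _ _ c) (smooth_bump_chart _ _ ac) fs).
  have oF : open (~` F) by exact: closed_openC.
  exists (~` F); split => //; first by move=> /Fc.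
  exact: (smooth_on_ext oF gout (smooth_on_cst 0 oF)).
move=> q [dq]; rewrite /= -ball_normE /= => qr.
by rewrite gin // box_bump1 ?mul1r // distrC ltW.
Qed.

End Cutoff.
(* Otherwise [done] unfolds these predicates and compares complex-valued
   functions, which is very slow. *)
Local Opaque csmooth smooth_on chart_smooth.

(** * Locality and linearity of bidifferential operators *)

Section Bidifferential.
Variables (R : realType) (n : nat) (M : complexManifold R n).
Notation chartM := (chart R n M).
Implicit Types (c : chartM) (V W : set M) (f g a b h : M -> R[i]) (p : M).

(** A multi-index derivative becomes one list of directions, on which the following lemmas go by
    plain induction. *)
Lemma multi_pdE c (d N : nat) (e : 'I_d -> 'I_(n + n))
    (K : {ffun 'I_d -> 'I_N.+1}) f :
  multi_pd c e K f =
  foldr (pd c) f (flatten [seq nseq (K k) (e k) | k <- enum 'I_d]).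
Proof.
rewrite /multi_pd; elim: (enum 'I_d) => //= k s ->.
by rewrite foldr_cat; elim: (nat_of_ord (K k)) => [|m /= ->].
Qed.

Lemma iter_pd_near c W f g s : open W -> W `<=` dom c ->
  (forall q, W q -> f q = g q) ->
  forall q, W q -> foldr (pd c) f s q = foldr (pd c) g s q.
Proof.
move=> oW Wc fg; elim: s => [|j s IH] q Wq; first exact: fg.
by apply: (pd_near j oW Wc).
Qed.

Lemma chart_smooth_iter_pd c W f s : open W -> W `<=` dom c ->
  chart_smooth c W f -> chart_smooth c W (foldr (pd c) f s).
Proof. by move=> oW Wc fs; elim: s => [|j s]; [exact: fs|exact: chart_smooth_pd]. Qed.

Lemma iter_pdD c W f g s : open W -> W `<=` dom c ->
  chart_smooth c W f -> chart_smooth c W g -> forall q, W q ->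
  foldr (pd c) (fun q => f q + g q) s q = foldr (pd c) f s q + foldr (pd c) g s q.
Proof.
move=> oW Wc fs gs; elim: s => [|j s IH] q Wq //=.
transitivity (pd c j (fun q => foldr (pd c) f s q + foldr (pd c) g s q) q).
  exact: (pd_near j oW Wc Wq IH).
exact: (pdD j (chart_smooth_iter_pd s oW Wc fs) (chart_smooth_iter_pd s oW Wc gs) Wq).
Qed.

Lemma iter_pdM c W h f s : open W -> W `<=` dom c ->
  chart_smooth c W h -> chart_smooth c W f ->
  (forall j q, j \in s -> W q -> pd c j h q = 0) -> forall q, W q ->
  foldr (pd c) (fun q => h q * f q) s q = h q * foldr (pd c) f s q.
Proof.
move=> oW Wc hs fs; elim: s => [|j s IH] h0 q Wq //=.
have {}IH := IH (fun i q si => h0 i q (@mem_behead _ (j :: s) i si)).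
transitivity (pd c j (fun q => h q * foldr (pd c) f s q) q).
  exact: (pd_near j oW Wc Wq IH).
rewrite (pdM j hs (chart_smooth_iter_pd s oW Wc fs) Wq Wc).
by rewrite (h0 j q (mem_head j s) Wq) mulr0 addr0.
Qed.

Lemma mem_flatten_nseq (d : nat) (e : 'I_d -> 'I_(n + n)) (K : 'I_d -> nat) j :
  j \in flatten [seq nseq (K k) (e k) | k <- enum 'I_d] -> exists k, j = e k.
Proof. by move=> /flatten_mapP[k _]; rewrite mem_nseq => /andP[_ /eqP]; exists k. Qed.

Variables (d1 d2 : nat) (e1 : 'I_d1 -> 'I_(n + n)) (e2 : 'I_d2 -> 'I_(n + n)).
Variable B : (M -> R[i]) -> (M -> R[i]) -> M -> R[i].
Hypothesis hB : bidiff_along e1 e2 B.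

(** The defining formula at the single point p, with the neighbourhood shrunk into W and the
    coefficients frozen to scalars. *)
Lemma bidiff_formula c W p : atlas c -> dom c p -> open W -> W p ->
  exists V N (coef : {ffun 'I_d1 -> 'I_N.+1} -> {ffun 'I_d2 -> 'I_N.+1} -> R[i]),
  [/\ open V, V p, V `<=` W, V `<=` dom c & forall a b, smooth_on V a ->
    smooth_on V b -> B a b p = \sum_K \sum_L
      coef K L * multi_pd c e1 K a p * multi_pd c e2 L b p].
Proof.
move=> ac dp oW Wp; have [V [oV Vp Vc [N [coef [_ BE]]]]] := hB ac dp.
exists (V `&` W), N, (fun K L => coef K L p); split=> //.
- exact: openI.
- by move=> q [Vq _]; exact: Vc.
move=> a b sa sb; apply: (BE (V `&` W)) => //; exact: openI.
Qed.

Lemma bidiff_local W a a' b b' p : open W -> W p ->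
  (forall q, W q -> a' q = a q) -> (forall q, W q -> b' q = b q) ->
  smooth_on W a -> smooth_on W b -> B a' b' p = B a b p.
Proof.
move=> oW Wp aa bb sa sb; have [c [ac dp]] := atlas_cover p.
have [V [N [coef [oV Vp VW Vc BE]]]] := bidiff_formula ac dp oW Wp.
have va := smooth_on_subset VW sa; have vb := smooth_on_subset VW sb.
have aaV q : V q -> a' q = a q by move=> /VW /aa.
have bbV q : V q -> b' q = b q by move=> /VW /bb.
rewrite (BE a b va vb).
rewrite (BE a' b' (smooth_on_ext oV aaV va) (smooth_on_ext oV bbV vb)).
apply: eq_bigr => K _; apply: eq_bigr => L _.
by rewrite !multi_pdE (iter_pd_near _ oV Vc aaV Vp) (iter_pd_near _ oV Vc bbV Vp).
Qed.

Lemma bidiffDr W a b b' p : open W -> W p ->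
  smooth_on W a -> smooth_on W b -> smooth_on W b' ->
  B a (fun q => b q + b' q) p = B a b p + B a b' p.
Proof.
move=> oW Wp sa sb sb'; have [c [ac dp]] := atlas_cover p.
have [V [N [coef [oV Vp VW Vc BE]]]] := bidiff_formula ac dp oW Wp.
have va := smooth_on_subset VW sa; have vb := smooth_on_subset VW sb.
have vb' := smooth_on_subset VW sb'.
rewrite (BE a b va vb) (BE a b' va vb') (BE a _ va (smooth_onD oV vb vb')).
rewrite -big_split /=; apply: eq_bigr => K _; rewrite -big_split /=.
apply: eq_bigr => L _; rewrite !multi_pdE.
rewrite (iter_pdD _ oV Vc (smooth_on_chart ac Vc vb) (smooth_on_chart ac Vc vb') Vp).
exact: mulrDr.
Qed.

Lemma bidiffMr c W a h b p : atlas c -> W `<=` dom c -> open W -> W p ->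
  smooth_on W a -> smooth_on W h -> smooth_on W b ->
  (forall k q, W q -> pd c (e2 k) h q = 0) ->
  B a (fun q => h q * b q) p = h p * B a b p.
Proof.
move=> ac Wc oW Wp sa sh sb h0; have dp := Wc p Wp.
have [V [N [coef [oV Vp VW Vc BE]]]] := bidiff_formula ac dp oW Wp.
have va := smooth_on_subset VW sa; have vb := smooth_on_subset VW sb.
have vh := smooth_on_subset VW sh.
rewrite (BE a b va vb) (BE a _ va (smooth_onM oV vh vb)).
rewrite mulr_sumr; apply: eq_bigr => K _; rewrite mulr_sumr.
apply: eq_bigr => L _; rewrite !multi_pdE.
rewrite (iter_pdM oV Vc (smooth_on_chart ac Vc vh) (smooth_on_chart ac Vc vb) _ Vp).
  exact: mulrCA.
by move=> j q /mem_flatten_nseq[k ->] /VW; exact: h0.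
Qed.

Lemma bidiffZr W a (s : R[i]) b p : open W -> W p ->
  smooth_on W a -> smooth_on W b -> B a (fun q => s * b q) p = s * B a b p.
Proof.
move=> oW Wp sa sb; have [c [ac dp]] := atlas_cover p.
have oWc : open (W `&` dom c) by apply: openI => //; exact: dom_open.
have sub : W `&` dom c `<=` W by move=> ? [].
have subc : W `&` dom c `<=` dom c by move=> ? [].
apply: (bidiffMr ac subc oWc (conj Wp dp) (smooth_on_subset sub sa)
  (smooth_on_cst s oWc) (smooth_on_subset sub sb)) => k q _.
exact: pd_cst.
Qed.

Lemma bidiff0r W a p : open W -> W p -> smooth_on W a -> B a (fun=> 0) p = 0.
Proof.
move=> oW Wp sa; have s0 := smooth_on_cst 0 oW.
rewrite -[RHS](mul0r (B a (fun=> 0) p)) -(bidiffZr 0 oW Wp sa s0).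
apply: (bidiff_local oW Wp _ _ sa (smooth_onM oW s0 s0)) => // q _.
by rewrite mul0r.
Qed.

(** Writing h as h times 1, the factor h passes through B like a constant and B(f, 1) = 0
    remains. *)
Lemma bidiff_killed c f h p : atlas c -> dom c p -> smooth_on (dom c) f ->
  smooth_on (dom c) h ->
  (forall k q, dom c q -> pd c (e2 k) h q = 0) -> B f (fun=> 1) p = 0 ->
  B f h p = 0.
Proof.
move=> ac dp sf sh h0 B1; have od := @dom_open _ _ _ c.
have s1 := smooth_on_cst 1 od.
have e q : dom c q -> h q = h q * 1 by rewrite mulr1.
rewrite (bidiff_local od dp (fun q _ => erefl (f q)) e sf (smooth_onM od sh s1)).
by rewrite (bidiffMr ac (@subset_refl _ _) od dp sf sh s1 h0) B1 mulr0.
Qed.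

(** Turns each statement about the second argument into one about the first, and the product into
    its opposite. *)
Lemma bidiff_swap : bidiff_along e2 e1 (fun a b => B b a).
Proof.
move=> c ac p dp; have [V [oV Vp Vc [N [coef [cs BE]]]]] := hB ac dp.
exists V; split => //; exists N, (fun K L => coef L K); split=> [K L|].
  exact: cs.
move=> W a b oW WV sa sb q Wq; rewrite (BE W) // exchange_big /=.
by apply: eq_bigr => K _; apply: eq_bigr => L _; rewrite mulrAC.
Qed.

End Bidifferential.
(** * Star products of Wick type *)

Section LocalStar.
Variables (R : realType) (n : nat) (M : complexManifold R n).
Notation chartM := (chart R n M).
Implicit Types (f g h : M -> R[i]) (a b : fseries M) (p q : M).

Definition deg0 f : fseries M := fun m => if m is 0%N then f else fun=> 0.

Lemma fmul_deg0l f b m p : fmul (deg0 f) b m p = f p * b m p.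
Proof.
by rewrite /fmul big_ord_recl /= subn0 big1 ?addr0 // => i _; rewrite mul0r.
Qed.

Lemma fmul_deg0r f b m p : fmul b (deg0 f) m p = b m p * f p.
Proof.
rewrite /fmul big_ord_recr /= subnn big1 ?add0r // => i _.
by have := ltn_ord i; rewrite -subn_gt0; case: (m - i)%N => // k _; rewrite mulr0.
Qed.

Variables (C : nat -> (M -> R[i]) -> (M -> R[i]) -> M -> R[i]).
Hypothesis hD : forall r, bidifferential (C r).
Variables (U : set M) (oU : open U).
Notation star := (star_mul C).

Lemma deg0_smooth f : smooth_on U f -> fsmooth_on U (deg0 f).
Proof. by move=> fs [|m]; [exact: fs|exact: smooth_on_cst]. Qed.

Lemma C0r r f p : U p -> smooth_on U f -> C r f (fun=> 0) p = 0.
Proof. by move=> Up; exact: (bidiff0r (hD r) oU Up). Qed.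

Lemma C0l r f p : U p -> smooth_on U f -> C r (fun=> 0) f p = 0.
Proof. by move=> Up; exact: (bidiff0r (bidiff_swap (hD r)) oU Up). Qed.

Lemma star_ext a a' b b' m p : U p -> fsmooth_on U a -> fsmooth_on U b ->
  (forall m q, U q -> a' m q = a m q) -> (forall m q, U q -> b' m q = b m q) ->
  star a' b' m p = star a b m p.
Proof.
move=> Up sa sb aa bb; apply: eq_bigr => r _; apply: eq_bigr => i _.
exact: (bidiff_local (hD r) oU Up (aa _) (bb _) (sa _) (sb _)).
Qed.

Lemma starDr a b b' m p : U p -> fsmooth_on U a -> fsmooth_on U b ->
  fsmooth_on U b' ->
  star a (fun m q => b m q + b' m q) m p = star a b m p + star a b' m p.
Proof.
move=> Up sa sb sb'; rewrite -big_split; apply: eq_bigr => r _.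
rewrite -big_split; apply: eq_bigr => i _.
exact: (bidiffDr (hD r) oU Up (sa _) (sb _) (sb' _)).
Qed.

Lemma star_deg0l f b m p : U p -> smooth_on U f -> fsmooth_on U b ->
  star (deg0 f) b m p = \sum_(r < m.+1) C r f (b (m - r)%N) p.
Proof.
move=> Up sf sb; apply: eq_bigr => r _; rewrite big_ord_recl /= subn0.
rewrite [X in _ + X]big1 ?addr0 // => i _; exact: (C0l _ Up (sb _)).
Qed.

Lemma star_mul_swap a b m p :
  star_mul (fun r f g => C r g f) a b m p = star_mul C b a m p.
Proof.
apply: eq_bigr => r _; rewrite (reindex_inj rev_ord_inj) /=.
apply: eq_bigr => i _; rewrite subSS subKn //.
by rewrite -ltnS.
Qed.

End LocalStar.

(** * Wick-type calculus, common to a product and its opposite *)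

Section WickCalculus.
Variables (R : realType) (n : nat) (M : complexManifold R n).
Notation chartM := (chart R n M).
Implicit Types (V W : set M) (f g h : M -> R[i]) (a b : fseries M) (p q : M).

(* Stable under exchanging the arguments of C together with e1 and e2, so that
   every consequence also holds with the holomorphic and anti-holomorphic
   directions interchanged. *)
Record wick_calculus (C : nat -> (M -> R[i]) -> (M -> R[i]) -> M -> R[i])
    (e1 e2 : 'I_n -> 'I_(n + n)) : Prop := WickCalculus {
  wick_inj : injective e1;
  wick_disj : forall k l, (e2 k == e1 l) = false;
  wick_bidiff : forall r, bidifferential (C r);
  wick_along : forall r, (0 < r)%N -> bidiff_along e1 e2 (C r);
  wick_C0 : forall c f g p, atlas c -> dom c p -> smooth_on (dom c) f ->
    smooth_on (dom c) g -> C 0 f g p = f p * g p;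
  wick_unit : forall r c f p, (0 < r)%N -> atlas c -> dom c p ->
    smooth_on (dom c) f -> C r f (fun=> 1) p = 0;
  wick_nondeg : forall c f p, atlas c -> dom c p -> smooth_on (dom c) f ->
    (forall k, C 1 (coord c (e1 k)) f p = 0) ->
    forall l, pd c (e2 l) f p = 0
}.

Variables (C : nat -> (M -> R[i]) -> (M -> R[i]) -> M -> R[i]).
Variables (e1 e2 : 'I_n -> 'I_(n + n)).
Hypothesis hC : wick_calculus C e1 e2.
Variables (c : chartM) (ac : atlas c).
Notation U := (dom c).
Notation star := (star_mul C).
Notation z k := (coord c (e1 k)).

Let oU : open U := @dom_open _ _ _ c.
Let hD := wick_bidiff hC.

(** Holomorphic on U for the product itself, anti-holomorphic on U for its opposite. *)
Definition killed h : Prop := forall k q, U q -> pd c (e2 k) h q = 0.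

Lemma killed_coord k : killed (z k).
Proof. by move=> l q dq; rewrite pd_coord // (wick_disj hC). Qed.

Lemma C_killed r f h p : (0 < r)%N -> U p -> smooth_on U f -> smooth_on U h ->
  killed h -> C r f h p = 0.
Proof.
move=> r0 Up fs hs h0.
exact: (bidiff_killed (wick_along hC r0) ac Up fs hs h0 (wick_unit hC r0 ac Up fs)).
Qed.

Lemma starMr h a b m p : U p -> fsmooth_on U a -> fsmooth_on U b ->
  smooth_on U h -> killed h ->
  star a (fun m q => h q * b m q) m p = h p * star a b m p.
Proof.
move=> Up sa sb sh h0; rewrite mulr_sumr; apply: eq_bigr => -[[|r] rm] _;
  rewrite mulr_sumr; apply: eq_bigr => i _ /=.
  rewrite (wick_C0 hC ac Up (sa i) (smooth_onM oU sh (sb _))).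
  by rewrite (wick_C0 hC ac Up (sa i) (sb _)) mulrCA.
exact: (bidiffMr (wick_along hC (ltn0Sn r)) ac (@subset_refl _ U) oU Up
  (sa _) sh (sb _) h0).
Qed.

Lemma killed_cst (s : R[i]) : killed (fun=> s).
Proof. by move=> k q _; exact: pd_cst. Qed.

Lemma star_sumr (s : seq 'I_n) (F : 'I_n -> fseries M) a m p : U p ->
  fsmooth_on U a -> (forall k, fsmooth_on U (F k)) ->
  star a (fun m q => \sum_(k <- s) F k m q) m p = \sum_(k <- s) star a (F k) m p.
Proof.
move=> Up sa sF; elim: s => [|k s IH].
  rewrite big_nil [LHS]big1 // => r _; rewrite big1 // => i _.
  transitivity (C r (a i) (fun=> 0) p); last exact: (C0r hD oU r Up (sa i)).
  by apply: (bidiff_local (hD r) oU Up (fun q _ => erefl _) _ (sa i)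
    (smooth_on_cst 0 oU)) => q _; rewrite big_nil.
have ss : fsmooth_on U (fun m q => \sum_(k <- s) F k m q).
  by move=> m'; apply: (smooth_on_sum s (F := fun k => F k m') oU) => k'; exact: sF.
rewrite big_cons -IH -(starDr hD oU _ Up sa (sF k) ss).
apply: (star_ext hD oU _ Up sa _ (fun _ _ _ => erefl _)) => [m'|m' q _].
  exact: (smooth_onD oU (sF k m') (ss m')).
by rewrite big_cons.
Qed.

Lemma star_killed a b m p : U p -> fsmooth_on U a -> fsmooth_on U b ->
  (forall m, killed (b m)) -> star a b m p = fmul a b m p.
Proof.
move=> Up sa sb b0; rewrite /star_mul big_ord_recl /= subn0 [X in _ + X]big1.
  rewrite addr0; apply: eq_bigr => i _.
  exact: (wick_C0 hC ac Up (sa i) (sb _)).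
move=> r _; rewrite big1 // => i _.
exact: (C_killed (ltn0Sn _) Up (sa i) (sb _) (b0 _)).
Qed.

(* The coefficient of nu^(m+1) only involves C_1 of the coordinate with f_m,
   where nondegeneracy applies, once f_0, .., f_(m-1) are known to be killed. *)
Lemma killed_of_star_coord (f : fseries M) : fsmooth_on U f ->
  (forall k m q, U q -> star (deg0 (z k)) f m q = z k q * f m q) ->
  forall m, killed (f m).
Proof.
move=> sf zf; elim/ltn_ind => m IH l q Uq.
apply: (wick_nondeg hC ac Uq (sf m)) => k.
have sz := smooth_coord (e1 k) ac.
have := zf k m.+1 q Uq; rewrite (star_deg0l hD oU _ Uq sz sf) !big_ord_recl /= subn0.
rewrite subSS subn0 (wick_C0 hC ac Uq sz (sf _)) => /eqP.
rewrite -subr_eq0 addrAC subrr add0r big1 ?addr0; first by move=> /eqP.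
move=> i _; apply: (C_killed (ltn0Sn _) Uq sz (sf _)); apply: IH.
by rewrite /bump /= !add1n subSS ltn_subrL (leq_ltn_trans (leq0n i) (ltn_ord i)).
Qed.

Variable u : 'I_n -> fseries M.
Hypothesis su : forall k, fsmooth_on U (u k).
Hypothesis hu : forall k a, fsmooth_on U a -> forall m p, U p ->
  star a (u k) m p =
  fmul a (u k) m p + numul (fun m' => pd c (e1 k) (a m')) m p.
Variable X : 'I_n -> M -> R[i].
Hypothesis sX : forall k, smooth_on U (X k).
Hypothesis X0 : forall k, killed (X k).
(** The sign [s] is 1 for the product and -1 for the opposite product. *)
Variables (s : R[i]) (a : fseries M).
Hypothesis sa : fsmooth_on U a.

Let Xu : fseries M := fun m q => \sum_k X k q * u k m q.
Let f : fseries M := fun m q => a m q + - s * Xu m q.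

Let sXu : fsmooth_on U Xu.
Proof.
move=> m; apply: (smooth_on_sum _ (F := fun k q => X k q * u k m q) oU) => k.
exact: (smooth_onM oU (sX k) (su k m)).
Qed.

Let ssXu (t : R[i]) : fsmooth_on U (fun m q => t * Xu m q).
Proof. by move=> m; apply: smooth_onM => //; exact: smooth_on_cst. Qed.

Let sf : fsmooth_on U f.
Proof. by move=> m; exact: (smooth_onD oU (sa m) (ssXu (- s) m)). Qed.

Let star_potential b m p : U p -> fsmooth_on U b ->
  star b (fun m q => f m q + s * Xu m q) m p =
  star b f m p + s * \sum_k X k p * (fmul b (u k) m p +
    numul (fun m' => pd c (e1 k) (b m')) m p).
Proof.
move=> Up sb.
rewrite (starDr hD oU _ Up sb sf (ssXu s)).
rewrite (starMr _ Up sb sXu (smooth_on_cst s oU) (killed_cst s)).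
congr (_ + s * _).
rewrite (@star_sumr _ (fun k m q => X k q * u k m q) b m p Up sb); last first.
  by move=> k m'; exact: (smooth_onM oU (sX k) (su k m')).
apply: eq_bigr => k _.
by rewrite (starMr _ Up sb (su k) (sX k) (X0 k)) (hu k sb m Up).
Qed.

Let aE m q : U q -> a m q = f m q + s * Xu m q.
Proof. by rewrite /f mulNr subrK. Qed.

Let sfX : fsmooth_on U (fun m q => f m q + s * Xu m q).
Proof. by move=> m; exact: (smooth_onD oU (sf m) (ssXu s m)). Qed.

Let pd_Xu m l p : U p ->
  pd c (e2 l) (Xu m) p = \sum_k X k p * pd c (e2 l) (u k m) p.
Proof.
move=> Up; have Uc : U `<=` U by [].
have cX k := smooth_on_chart ac Uc (sX k).
have cu k := smooth_on_chart ac Uc (su k m).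
rewrite (@pd_sum _ _ _ c U _ _ (fun k q => X k q * u k m q) _ p oU Uc _ Up).
  apply: eq_bigr => k _; rewrite (pdM _ (cX k) (cu k) Up Uc).
  by rewrite (X0 k l Up) mulr0 addr0.
by move=> k; apply: (smooth_on_chart ac Uc); exact: (smooth_onM oU (sX k) (su k m)).
Qed.

Let pd_f m l p : U p ->
  pd c (e2 l) (f m) p = pd c (e2 l) (a m) p - s * pd c (e2 l) (Xu m) p.
Proof.
move=> Up; have Uc : U `<=` U by [].
have ca := smooth_on_chart ac Uc (sa m).
have cXu := smooth_on_chart ac Uc (sXu m).
have cs := smooth_on_chart ac Uc (smooth_on_cst (- s) oU).
have csXu := smooth_on_chart ac Uc (ssXu (- s) m).
rewrite (pdD (e2 l) ca csXu Up) (pdM (e2 l) cs cXu Up Uc) pd_cst mulr0 addr0.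
by rewrite mulNr.
Qed.

Lemma numul_pd_deg0_coord j k m p : U p ->
  numul (fun m' => pd c (e1 k) (deg0 (z j) m')) m p =
  (m == 1)%:R * (k == j)%:R.
Proof.
move=> Up; case: m => [|[|m]] /=; rewrite ?mul0r ?mul1r ?pd_cst //.
by rewrite pd_coord // (inj_eq (wick_inj hC)).
Qed.

(** The claim says that a - s X^k u_k is killed, and by [killed_of_star_coord] this can be tested on
    coordinates; so the commutator hypothesis concerns coordinates only. *)
Lemma potential_of_commutator :
  (forall k m p, U p -> star (deg0 (z k)) a m p - star a (deg0 (z k)) m p =
     s * ((m == 1)%:R * X k p)) ->
  forall m l p, U p ->
    pd c (e2 l) (a m) p = s * \sum_k X k p * pd c (e2 l) (u k m) p.
Proof.
move=> comm m l p Up; apply/eqP; rewrite -subr_eq0 -pd_Xu // -pd_f //; apply/eqP.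
apply: (killed_of_star_coord sf) Up => {l p}k {}m q Uq.
have sz := deg0_smooth oU (smooth_coord (e1 k) ac).
have zk m' : killed (deg0 (z k) m').
  by case: m' => [|m']; [exact: killed_coord|exact: killed_cst].
have := comm k m q Uq; rewrite (star_killed m Uq sa sz zk) fmul_deg0r.
rewrite (star_ext hD oU _ Uq sz sfX (fun _ _ _ => erefl _) aE) star_potential //.
(* The derivative term nu Z_k0 z^k survives only for k0 = k, and only in degree one. *)
have -> : \sum_k0 X k0 q * (fmul (deg0 (z k)) (u k0) m q +
    numul (fun m' => pd c (e1 k0) (deg0 (z k) m')) m q) =
    z k q * Xu m q + (m == 1)%:R * X k q.
  rewrite /Xu mulr_sumr [X in _ + X](_ : _ =
    \sum_k0 X k0 q * ((m == 1)%:R * (k0 == k)%:R)); last first.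
    rewrite (bigD1 k) //= eqxx mulr1 mulrC big1 ?addr0 // => k0 /negbTE ->.
    by rewrite !mulr0.
  rewrite -big_split; apply: eq_bigr => k0 _ /=.
  by rewrite fmul_deg0l numul_pd_deg0_coord // mulrDr mulrCA.
rewrite (aE m Uq); move: (star _ _ _ _) (z k q) (f m q) (Xu m q) (_ * X k q).
move=> A B D E G H.
(* Here A is the coefficient of z^k star f and B D the pointwise one; the left combination is the
   commutator, known from H to be s G. *)
transitivity (A + s * (B * E + G) - (D + s * E) * B - s * (B * E + G) +
  (D + s * E) * B); first by ring.
by rewrite H; ring.
Qed.

Lemma commutator_of_potential :
  (forall m l p, U p ->
    pd c (e2 l) (a m) p = s * \sum_k X k p * pd c (e2 l) (u k m) p) ->
  forall b m p, fsmooth_on U b -> U p ->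
    star b a m p = fmul b a m p +
      s * numul (fun m' q => \sum_k X k q * pd c (e1 k) (b m') q) m p.
Proof.
move=> da b m p sb Up.
(* The potential equation is exactly the vanishing of these derivatives; b star f then reduces to
   the pointwise product. *)
have f0 m' : killed (f m').
  by move=> l q Uq; rewrite pd_f // pd_Xu // da // subrr.
rewrite (star_ext hD oU _ Up sb sfX (fun _ _ _ => erefl _) aE) star_potential //.
rewrite (star_killed m Up sb sf f0).
have -> : fmul b a m p = fmul b f m p + s * \sum_k X k p * fmul b (u k) m p.
  under [X in _ + s * X]eq_bigr do rewrite mulr_sumr.
  rewrite exchange_big mulr_sumr -big_split; apply: eq_bigr => i _ /=.
  rewrite (aE _ Up) mulrDr /Xu !mulr_sumr; congr (_ + _).
  by apply: eq_bigr => k _; ring.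
have -> : numul (fun m' q => \sum_k X k q * pd c (e1 k) (b m') q) m p =
    \sum_k X k p * numul (fun m' => pd c (e1 k) (b m')) m p.
  by case: m => [|m] //=; rewrite big1 // => k _; rewrite mulr0.
rewrite -addrA -mulrDr -big_split; congr (_ + _ * _).
by apply: eq_bigr => k _; rewrite mulrDr.
Qed.

End WickCalculus.

(** * Holomorphy of the components of a derivation *)

Section WickComponents.
Variables (R : realType) (n : nat) (M : complexManifold R n).
Variables (C : nat -> (M -> R[i]) -> (M -> R[i]) -> M -> R[i]).
Variables (e1 e2 : 'I_n -> 'I_(n + n)).
Hypothesis hC : wick_calculus C e1 e2.
Variable X : vector_field M.

Lemma vact_field_coord c j p : atlas c -> dom c p ->
  vact X (coord c j) p = X c p ord0 j.
Proof.
move=> ac dp.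
rewrite (@vact_chart _ _ _ X c (dom c) _ p (fun c' ac' dp' => vf_change X ac ac' dp dp')
  ac dp (@dom_open _ _ _ c) (smooth_coord j ac) dp).
rewrite (bigD1 j) //= pd_coord // eqxx mulr1 big1 ?addr0 // => k /negbTE kj.
by rewrite pd_coord // kj mulr0.
Qed.

(** Apply the Leibniz rule to C_1(z^j, z^k). This vanishes near p, and so does C_1(X z^j, z^k),
    since z^k is killed; what remains is C_1(z^j, X^k) = 0, and nondegeneracy concludes. The rule is
    symmetric in both arguments of C_1, so it holds for the opposite product too. *)
Lemma killed_component c : atlas c ->
  (forall W f g p, open W -> W p -> smooth f -> smooth g ->
     smooth_on W (vact X f) -> smooth_on W (vact X g) ->
     vact X (C 1 f g) p = C 1 (vact X f) g p + C 1 f (vact X g) p) ->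
  forall k, killed e2 c (fun q => X c q ord0 (e1 k)).
Proof.
move=> ac hX k l p Up; have sX j := vf_smooth X ac j.
apply: (wick_nondeg hC ac Up (sX _)) => j.
have [W [oW Wp Wc ext]] := extension ac Up.
have sz i := smooth_coord (e1 i) ac.
have [gj sgj gjE] := ext _ (sz j); have [gk sgk gkE] := ext _ (sz k).
have vX g i : (forall q, W q -> g q = coord c i q) ->
    forall q, W q -> vact X g q = X c q ord0 i.
  move=> gE q Wq; rewrite (vact_near X oW Wq gE).
  exact: (vact_field_coord i ac (Wc q Wq)).
have sXW i := smooth_on_subset Wc (sX i).
have szW i := smooth_on_subset Wc (sz i).
have loc := bidiff_local (wick_bidiff hC 1) oW.
have CW q : W q -> C 1 gj gk q = 0.
  move=> Wq; rewrite (loc _ _ _ _ q Wq gjE gkE (szW j) (szW k)).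
  exact: (C_killed hC ac (ltn0Sn 0) (Wc q Wq) (sz j) (sz k) (killed_coord hC k)).
have vj := vX gj _ gjE; have vk := vX gk _ gkE.
have := hX W gj gk p oW Wp sgj sgk (smooth_on_ext oW vj (sXW _))
  (smooth_on_ext oW vk (sXW _)).
rewrite (vact_near X oW Wp CW) vact_cst.
rewrite (loc _ _ _ _ p Wp vj gkE (sXW _) (szW k)).
rewrite (C_killed hC ac (ltn0Sn 0) Up (sX _) (sz k) (killed_coord hC k)) add0r.
by rewrite (loc _ _ _ _ p Wp gjE vk (szW j) (sXW _)) => <-.
Qed.

End WickComponents.

(** * Hamiltonian vector fields and the Poisson bracket in charts *)

Section Hamiltonian.
Variables (R : realType) (n : nat) (M : complexManifold R n) (w : two_form M).
Hypothesis hw : pseudo_kahler w.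
Notation chartM := (chart R n M).
Implicit Types (c : chartM) (W : set M) (f g : M -> R[i]) (p : M).

Lemma hamiltonian_change c c' W f p : atlas c -> atlas c' -> open W -> W p ->
  smooth_on W f -> dom c p -> dom c' p ->
  hamiltonian w f c' p = hamiltonian w f c p *m jacobian c c' p.
Proof.
move=> ac ac' oW Wp sf dp dp'; rewrite /hamiltonian.
have [_ uA _ _] := hw ac dp; have [_ uA' _ _] := hw ac' dp'.
have wE := tf_change w ac ac' dp dp'.
(* The Jacobian is a factor of the invertible matrix of w, hence invertible without inverting the
   change of charts. *)
have uJ : jacobian c c' p \in unitmx.
  by move: uA; rewrite wE !unitmx_mul => /andP[/andP[]].
have uJT : (jacobian c c' p)^T \in unitmx by rewrite unitmx_tr.
rewrite (differential_change ac ac' oW sf Wp dp dp').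
apply: (can_inj (mulmxK uA')); rewrite mulmxKV //.
apply: (can_inj (mulmxK uJT)).
by rewrite -!mulmxA (mulmxA (jacobian c c' p)) -wE mulVmx // mulmx1.
Qed.

Lemma poisson_chart c W f g p : atlas c -> dom c p -> open W -> W p ->
  smooth_on W f -> smooth_on W g ->
  poisson w f g p = - \sum_j hamiltonian w f c p ord0 j * pd c j g p.
Proof.
move=> ac dp oW Wp sf sg; rewrite /poisson; apply: congr1.
apply: (vact_chart _ ac dp oW sg Wp) => c' ac' dp'.
exact: (hamiltonian_change ac ac' oW Wp sf dp dp').
Qed.

Lemma poisson_near W f f' g g' p : open W -> W p ->
  (forall q, W q -> f' q = f q) -> (forall q, W q -> g' q = g q) ->
  poisson w f' g' p = poisson w f g p.
Proof.
move=> oW Wp ff gg; rewrite /poisson /vact.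
have [ac dp] := projT2 (cid (atlas_cover p)); rewrite -/(chart_at p) in ac dp *.
move: (chart_at p) ac dp => c ac dp.
have oWc : open (W `&` dom c) by apply: openI => //; exact: dom_open.
have Wc : W `&` dom c `<=` dom c by move=> ? [].
have pdE h h' j : (forall q, W q -> h' q = h q) -> pd c j h' p = pd c j h p.
  move=> hh; apply: (pd_near j oWc Wc) => [|q [Wq _]]; first by split.
  exact: hh.
have dE : differential f' c p = differential f c p.
  by apply/rowP => i; rewrite [LHS]mxE [RHS]mxE; exact: pdE ff.
apply: congr1; apply: eq_bigr => j _; rewrite (pdE g g' j gg).
by rewrite /hamiltonian dE.
Qed.

(** Up to sign the brackets with the e1-coordinates are the e1-entries of y = w^-1 df. If they
    vanish, y lives on the e2-indices, where w pairs to zero by type (1,1), so the e2-entries of df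
    = w y vanish. *)
Lemma poisson_coord_nondeg (e1 e2 : 'I_n -> 'I_(n + n)) c f p :
  (forall j, (exists k, j = e1 k) \/ (exists k, j = e2 k)) ->
  (forall c p, atlas c -> dom c p -> forall k l, w c p (e2 k) (e2 l) = 0) ->
  atlas c -> dom c p -> smooth_on (dom c) f ->
  (forall k, poisson w (coord c (e1 k)) f p = 0) ->
  forall l, pd c (e2 l) f p = 0.
Proof.
move=> cover w0 ac dp sf pz l; have od := @dom_open _ _ _ c.
have [_ uA _ _] := hw ac dp.
pose D : 'cV[R[i]]_(n + n) := \col_j pd c j f p.
pose y := invmx (w c p) *m D.
have y0 k : y (e1 k) ord0 = 0.
  have := pz k; rewrite (poisson_chart ac dp od dp (smooth_coord _ ac) sf).
  move=> /eqP; rewrite oppr_eq0 => /eqP <-; rewrite mxE.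
  apply: eq_bigr => j _; rewrite [D _ _]mxE; congr (_ * _).
  rewrite mxE (bigD1 (e1 k)) //= mxE pd_coord // eqxx mul1r big1 ?addr0 //.
  by move=> i /negbTE ik; rewrite mxE pd_coord // ik mul0r.
have -> : pd c (e2 l) f p = D (e2 l) ord0 by rewrite mxE.
have -> : D = w c p *m y by rewrite mulmxA mulmxV // mul1mx.
rewrite mxE big1 // => j _; case: (cover j) => -[k ->]; first by rewrite y0 mulr0.
by rewrite w0 // mul0r.
Qed.

End Hamiltonian.

(** * The axioms of the star product on chart functions *)

Section WickStarProduct.
Variables (R : realType) (n : nat) (M : complexManifold R n) (w : two_form M).
Hypothesis hw : pseudo_kahler w.
Variable S : star_product w.
Hypothesis hS : wick_type S.
Notation C := (sp_coef S).
Notation hD := (sp_bidiff S).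
Notation chartM := (chart R n M).
Implicit Types (c : chartM) (W : set M) (f g : M -> R[i]) (p : M).

Lemma sp_coef_extend c f g p : atlas c -> dom c p -> smooth_on (dom c) f ->
  smooth_on (dom c) g -> exists f' g' W,
  [/\ smooth f' /\ smooth g', open W /\ W p, forall q, W q -> f' q = f q,
      forall q, W q -> g' q = g q &
      forall r, C r f' g' p = C r f g p /\ C r g' f' p = C r g f p].
Proof.
move=> ac dp sf sg; have [W [oW Wp Wc ext]] := extension ac dp.
have [f' sf' f'E] := ext _ sf; have [g' sg' g'E] := ext _ sg.
have sfW := smooth_on_subset Wc sf; have sgW := smooth_on_subset Wc sg.
exists f', g', W; split=> // r.
by split; [exact: (bidiff_local (hD r) oW Wp f'E g'E sfW sgW)
  |exact: (bidiff_local (hD r) oW Wp g'E f'E sgW sfW)].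
Qed.

Lemma sp_C0_local c f g p : atlas c -> dom c p -> smooth_on (dom c) f ->
  smooth_on (dom c) g -> C 0 f g p = f p * g p.
Proof.
move=> ac dp sf sg.
have [f' [g' [W [[sf' sg'] [oW Wp] f'E g'E CE]]]] := sp_coef_extend ac dp sf sg.
by have [<- _] := CE 0%N; rewrite (sp_C0 S sf' sg') f'E // g'E.
Qed.

Lemma sp_C1_local c f g p : atlas c -> dom c p -> smooth_on (dom c) f ->
  smooth_on (dom c) g -> C 1 f g p - C 1 g f p = poisson w f g p.
Proof.
move=> ac dp sf sg.
have [f' [g' [W [[sf' sg'] [oW Wp] f'E g'E CE]]]] := sp_coef_extend ac dp sf sg.
have [<- <-] := CE 1%N; rewrite (sp_C1 S sf' sg').
exact: (poisson_near w oW Wp f'E g'E).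
Qed.

Lemma deg0_fsmooth f : smooth f -> fsmooth (deg0 f).
Proof. by move=> sf; exact: (deg0_smooth openT). Qed.

(** In degree r the product of f with the unit series is just C_r(f, 1), while f, as a series, has
    no term of degree r > 0. *)
Lemma sp_unit_local r c f p : (0 < r)%N -> atlas c -> dom c p ->
  smooth_on (dom c) f -> C r f (fun=> 1) p = 0 /\ C r (fun=> 1) f p = 0.
Proof.
move=> r0 ac dp sf; have s1 := smooth_on_cst 1 (@dom_open _ _ _ c).
have [f' [g' [W [[sf' sg'] [oW Wp] f'E g'E CE]]]] := sp_coef_extend ac dp sf s1.
have [<- <-] := CE r.
have s1' : @smooth R n M (fun=> 1) := smooth_on_cst 1 openT.
have one m : @fone R n M m = deg0 (fun=> 1) m.
  by apply/funext => q; case: m.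
have s1T := deg0_fsmooth s1'; have sfT := deg0_fsmooth sf'.
have gW := smooth_on_subset (@subsetT _ W).
have fin (C' : nat -> (M -> R[i]) -> (M -> R[i]) -> M -> R[i]) :
    (forall r, bidifferential (C' r)) ->
    star_mul C' (deg0 f') (deg0 (fun=> 1)) r p = 0 -> C' r f' (fun=> 1) p = 0.
  move=> hD'; rewrite (star_deg0l hD' openT r I sf' s1T) big_ord_recr /= subnn.
  rewrite big1 ?add0r // => i _; have := ltn_ord i; rewrite -subn_gt0.
  by case: (r - i)%N => // k _; exact: (C0r hD' openT i I sf').
have fE : (deg0 f' : fseries M) r p = 0 by case: (r) r0.
have -> : C r f' g' p = C r f' (fun=> 1) p.
  exact: (bidiff_local (hD r) oW Wp (fun q _ => erefl _) g'E (gW _ sf') (gW _ s1')).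
have -> : C r g' f' p = C r (fun=> 1) f' p.
  exact: (bidiff_local (hD r) oW Wp g'E (fun q _ => erefl _) (gW _ s1') (gW _ sf')).
have oneE : deg0 (fun=> 1) = @fone R n M by apply/funext => m; rewrite one.
split.
  by apply: fin; [exact: hD|rewrite oneE (sp_unitr S sfT)].
apply: (fin (fun r f g => C r g f)) => [r'|]; first exact: (bidiff_swap (hD r')).
by rewrite star_mul_swap oneE (sp_unitl S sfT).
Qed.

Lemma hol_or_anti (j : 'I_(n + n)) :
  (exists k : 'I_n, j = lshift n k) \/ (exists k : 'I_n, j = rshift n k).
Proof.
by rewrite -(splitK j); case: (fintype.split j) => k; [left|right]; exists k.
Qed.

Lemma kahler_hol c p : atlas c -> dom c p -> forall k l : 'I_n,
  w c p (lshift n k) (lshift n l) = 0.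
Proof. by move=> ac dp k l; have [_ _ /(_ k l)[]] := hw ac dp. Qed.

Lemma kahler_anti c p : atlas c -> dom c p -> forall k l : 'I_n,
  w c p (rshift n k) (rshift n l) = 0.
Proof. by move=> ac dp k l; have [_ _ /(_ k l)[]] := hw ac dp. Qed.

Lemma sp_wick_calculus :
  wick_calculus C (fun k : 'I_n => lshift n k) (fun k : 'I_n => rshift n k).
Proof.
split.
- exact: lshift_inj.
- by move=> k l; exact: eq_rlshift.
- exact: hD.
- exact: hS.
- exact: sp_C0_local.
- by move=> r c f p r0 ac dp sf; have [] := sp_unit_local r0 ac dp sf.
move=> c f p ac dp sf z0.
apply: (poisson_coord_nondeg hw hol_or_anti kahler_anti ac dp sf) => k.
have sz := smooth_coord (lshift n k) ac.
(* C_1(f, z^k) vanishes since z^k is holomorphic, so C_1(z^k, f) is the whole Poisson bracket. *)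
rewrite -(sp_C1_local ac dp sz sf) z0 sub0r.
rewrite (bidiff_killed (hS (ltn0Sn 0)) ac dp sf sz) ?oppr0 //.
  by move=> l q dq; rewrite pd_coord // eq_rlshift.
by have [] := sp_unit_local (ltn0Sn 0) ac dp sf.
Qed.

Lemma sp_wick_calculus_swap :
  wick_calculus (fun r f g => C r g f)
    (fun k : 'I_n => rshift n k) (fun k : 'I_n => lshift n k).
Proof.
split.
- exact: rshift_inj.
- by move=> k l; exact: eq_lrshift.
- by move=> r; exact: (bidiff_swap (hD r)).
- by move=> r r0; exact: (bidiff_swap (hS r0)).
- by move=> c f g p ac dp sf sg; rewrite mulrC; exact: (sp_C0_local ac dp sg sf).
- by move=> r c f p r0 ac dp sf; have [] := sp_unit_local r0 ac dp sf.
move=> c f p ac dp sf z0.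
apply: (@poisson_coord_nondeg _ _ _ _ hw (fun k : 'I_n => rshift n k)
  (fun k : 'I_n => lshift n k) c f p _ kahler_hol ac dp sf) => [j|k].
  by case: (hol_or_anti j) => H; [right|left]; exact: H.
have sz := smooth_coord (rshift n k) ac.
rewrite -(sp_C1_local ac dp sz sf) z0 subr0.
rewrite (bidiff_killed (bidiff_swap (hS (ltn0Sn 0))) ac dp sf sz) //.
  by move=> l q dq; rewrite pd_coord // eq_lrshift.
by have [] := sp_unit_local (ltn0Sn 0) ac dp sf.
Qed.

Variable X : vector_field M.

(** The degree-one part of the derivation property: X does not involve nu, so it maps functions of
    degree zero to such functions, whose product has C_1 as its degree-one coefficient. *)
Lemma derivation_C1 W f g p : star_derivation S X -> open W -> W p ->
  smooth f -> smooth g -> smooth_on W (vact X f) -> smooth_on W (vact X g) ->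
  vact X (C 1 f g) p = C 1 (vact X f) g p + C 1 f (vact X g) p.
Proof.
move=> hX oW Wp sf sg sXf sXg.
have gW := smooth_on_subset (@subsetT _ W).
have star1 V f' g' q : open V -> V q -> smooth_on V f' -> smooth_on V g' ->
    star_mul C (deg0 f') (deg0 g') 1 q = C 1 f' g' q.
  move=> oV Vq sf' sg'; rewrite (star_deg0l hD oV _ Vq sf' (deg0_smooth oV sg')).
  rewrite !big_ord_recl big_ord0 /= addr0.
  by rewrite (C0r hD oV 0 Vq sf') add0r.
have Xdeg h : fvact X (deg0 h) = deg0 (vact X h).
  apply/funext => -[|m] //; apply/funext => q; exact: vact_cst.
have := hX _ _ (deg0_fsmooth sf) (deg0_fsmooth sg) 1%N p.
rewrite !Xdeg /star (star1 W _ _ p oW Wp sXf (gW _ sg)).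
rewrite (star1 W _ _ p oW Wp (gW _ sf) sXg) => <-.
apply: (vact_near X openT I) => q _; symmetry.
exact: (star1 setT _ _ q openT I sf sg).
Qed.

Lemma commutator_coord a c j m p : fsmooth a -> implements S a X ->
  atlas c -> dom c p ->
  star S (deg0 (coord c j)) a m p - star S a (deg0 (coord c j)) m p =
  (m == 1)%:R * X c p ord0 j.
Proof.
move=> sa aX ac dp; have [W [oW Wp Wc ext]] := extension ac dp.
have sz := smooth_coord j ac; have [g sg gE] := ext _ sz.
have szW := deg0_smooth oW (smooth_on_subset Wc sz).
have saW : fsmooth_on W a.
  by move=> m'; exact: (smooth_on_subset (@subsetT _ W) (sa m')).
have gdE m' q : W q -> deg0 g m' q = deg0 (coord c j) m' q.
  by case: m' => // Wq; exact: gE.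
rewrite /star -(star_ext hD oW m Wp szW saW gdE (fun _ _ _ => erefl _)).
rewrite -(star_ext hD oW m Wp saW szW (fun _ _ _ => erefl _) gdE).
have := aX _ (deg0_fsmooth sg) m p; rewrite /ad_star /star opprB => <-.
(* The shift by nu moves X z^j to degree one; in higher degrees X acts on the zero function. *)
case: m => [|[|m]] /=; rewrite ?mul0r ?mul1r //; last exact: vact_cst.
by rewrite /fvact /= (vact_near X oW Wp gE); exact: vact_field_coord.
Qed.

End WickStarProduct.

(** * Components of the contraction of X with Karabegov's form *)

Section CharacterizingForm.
Variables (R : realType) (n : nat) (M : complexManifold R n).
Variables (X : vector_field M) (K : two_form M) (c : chart R n M) (p : M).

Lemma is_anti_hol (k : 'I_n) : is_anti (lshift n k) = false.
Proof. by rewrite /is_anti /= leqNgt ltn_ord. Qed.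

Lemma is_anti_anti (k : 'I_n) : is_anti (rshift n k) = true.
Proof. by rewrite /is_anti /= leq_addr. Qed.

Lemma pdN (W : set M) f j : open W -> W `<=` dom c -> chart_smooth c W f ->
  W p -> pd c j (fun q => - f q) p = - pd c j f p.
Proof.
move=> oW Wc fs Wp.
have s1 : chart_smooth c W (fun=> -1) by apply: csmooth_cst; exact: open_phi.
have -> : (fun q => - f q) = (fun q => -1 * f q).
  by apply/funext => q; rewrite mulN1r.
by rewrite (pdM j s1 fs Wp Wc) pd_cst mulr0 addr0 mulN1r.
Qed.

Lemma contraction_anti (u : 'I_n -> M -> R[i]) l : atlas c -> dom c p ->
  (forall k, smooth_on (dom c) (u k)) ->
  K c p = dbar c (form10 (fun k q => - u k q)) p ->
  contraction X K c p ord0 (rshift n l) =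
  \sum_k X c p ord0 (lshift n k) * pd c (rshift n l) (u k) p.
Proof.
move=> ac dp su KE; have Uc : dom c `<=` dom c by [].
rewrite /contraction mxE big_split_ord /= [X in _ + X]big1 ?addr0.
  apply: eq_bigr => k _; rewrite KE mxE is_anti_hol is_anti_anti sub0r.
  rewrite /form10 split_lshift.
  rewrite (pdN _ (@dom_open _ _ _ c) Uc (smooth_on_chart ac Uc (su k)) dp).
  by rewrite opprK.
move=> k _; rewrite KE mxE !is_anti_anti /form10 !split_rshift !pd_cst.
by rewrite subrr mulr0.
Qed.

(** The entry of del (v_k dzbar^k) at (Zbar_k, Z_l) is -Z_l v_k. The factor -1 is kept in front as
    the value of [s] for the opposite product. *)
Lemma contraction_hol (v : 'I_n -> M -> R[i]) l :
  K c p = del c (form01 v) p ->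
  contraction X K c p ord0 (lshift n l) =
  -1 * \sum_k X c p ord0 (rshift n k) * pd c (lshift n l) (v k) p.
Proof.
move=> KE.
rewrite /contraction mxE big_split_ord /= [X in X + _]big1 ?add0r.
  rewrite mulr_sumr; apply: eq_bigr => k _.
  rewrite KE mxE is_anti_hol is_anti_anti sub0r.
  by rewrite /form01 split_rshift mulN1r mulrN.
move=> k _; rewrite KE mxE !is_anti_hol /form01 !split_lshift !pd_cst.
by rewrite subrr mulr0.
Qed.

End CharacterizingForm.
(** * Potentials and inner derivations *)

Section Potentials.
Variables (R : realType) (n : nat) (M : complexManifold R n) (w : two_form M).
Hypothesis hw : pseudo_kahler w.
Variable S : star_product w.
Hypothesis hS : wick_type S.
Variable K : nat -> two_form M.
Hypothesis hK : characterizing_form S K.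
Variable X : vector_field M.
Hypothesis hX : star_derivation S X.
Notation C := (sp_coef S).
Notation C' := (fun r f g => sp_coef S r g f).
Notation wick := (sp_wick_calculus hw hS).
Notation wick' := (sp_wick_calculus_swap hw hS).

Lemma fmulC (a b : fseries M) m p : fmul a b m p = fmul b a m p.
Proof.
rewrite /fmul (reindex_inj rev_ord_inj) /=; apply: eq_bigr => i _.
have im : (i <= m)%N by rewrite -ltnS.
by rewrite subSS (subKn im); exact: mulrC.
Qed.

(** For the opposite product, the equation of v has the shape of the equation of u. *)
Lemma karabegov_v_swap c v : karabegov_v S c v ->
  forall k a, fsmooth_on (dom c) a -> forall m p, dom c p ->
  star_mul C' a (v k) m p =
  fmul a (v k) m p + numul (fun m' => pd c (rshift n k) (a m')) m p.
Proof. by move=> [_ hv] k a sa m p dp; rewrite star_mul_swap fmulC; exact: hv. Qed.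

Lemma killed_hol_component c : atlas c ->
  forall k : 'I_n, killed (fun l : 'I_n => rshift n l) c
    (fun q => X c q ord0 (lshift n k)).
Proof.
move=> ac; apply: (killed_component wick ac) => W f g p oW Wp.
exact: derivation_C1 hX oW Wp.
Qed.

Lemma killed_anti_component c : atlas c ->
  forall k : 'I_n, killed (fun l : 'I_n => lshift n l) c
    (fun q => X c q ord0 (rshift n k)).
Proof.
move=> ac; apply: (killed_component wick' ac) => W f g p oW Wp sf sg sXf sXg.
by rewrite addrC; exact: derivation_C1 hX oW Wp sg sf sXg sXf.
Qed.

(** In degree one the terms a_1 f of both products cancel, leaving X f = C_1(f, a_0) - C_1(a_0, f),
    which is -{a_0, f}. *)
Lemma implements_vact_hamiltonian a f p : fsmooth a -> implements S a X ->
  smooth f -> vact X f p = vact (hamiltonian w (a 0%N)) f p.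
Proof.
move=> sa aX sf.
have := aX _ (deg0_fsmooth sf) 1%N p; rewrite /ad_star /star opprB.
rewrite (star_deg0l (sp_bidiff S) openT 1 I sf sa) -star_mul_swap.
rewrite (star_deg0l (fun r => bidiff_swap (sp_bidiff S r)) openT 1 I sf sa).
rewrite !big_ord_recl !big_ord0 /= !addr0 (sp_C0 S sf (sa _)) (sp_C0 S (sa _) sf).
rewrite /fvact /= => ->; have := sp_C1 S (sa 0%N) sf p; rewrite /poisson.
rewrite /bump /= addn0 subnn mulrC => /(congr1 -%R); rewrite opprK opprB => <-.
by rewrite opprD addrACA subrr add0r.
Qed.

Lemma potential_of_implements a : fsmooth a -> implements S a X ->
  is_potential a X K.
Proof.
move=> sa aX m c0 ac0 p dp0; have [K1 K2] := hK.
have [c [ac dp ctr [u hu] [v hv]]] := K2 p; have [Ku Kv] := K1 c ac ctr.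
(* u and v are only provided in some chart c around p; both sides transform alike, so the identity
   passes to the given chart. *)
suff dE : differential (a m) c p = contraction X (K m) c p.
  rewrite (differential_change ac0 ac openT (sa m) I dp0 dp) dE /contraction.
  by rewrite (vf_change X ac0 ac dp0 dp) (tf_change (K m) ac0 ac dp0 dp) !mulmxA.
have Ua : fsmooth_on (dom c) a.
  by move=> m'; exact: (smooth_on_subset (@subsetT _ _) (sa m')).
have sX j := vf_smooth X ac j.
(* The (1,0) components come from the opposite product with s = -1, the (0,1) components from the
   product with s = 1. *)
apply/rowP => j; case: (hol_or_anti j) => -[l ->]; rewrite mxE.
  rewrite (contraction_hol X l (Kv v hv m p dp)).
  apply: (potential_of_commutator wick' ac hv.1 (karabegov_v_swap hv)
    (fun k => sX (rshift n k)) (killed_anti_component ac) Ua _ m l dp).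
  move=> k m' q dq; rewrite mulN1r.
  rewrite -(commutator_coord (rshift n k) m' sa aX ac dq) opprB.
  by congr (_ - _); exact: star_mul_swap.
rewrite (contraction_anti X l ac dp (fun k => hu.1 k m) (Ku u hu m p dp)).
rewrite -[RHS]mul1r.
apply: (potential_of_commutator wick ac hu.1 hu.2
  (fun k => sX (lshift n k)) (killed_hol_component ac) Ua _ m l dp).
move=> k m' q dq; rewrite mul1r.
exact: (commutator_coord (lshift n k) m' sa aX ac dq).
Qed.

Lemma implements_of_potential a : fsmooth a -> is_potential a X K ->
  implements S a X.
Proof.
move=> sa pa b sb m p; have [K1 K2] := hK.
have [c [ac dp ctr [u hu] [v hv]]] := K2 p; have [Ku Kv] := K1 c ac ctr.
have Us (d : fseries M) : fsmooth d -> fsmooth_on (dom c) d.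
  by move=> sd m'; exact: (smooth_on_subset (@subsetT _ _) (sd m')).
have sX j := vf_smooth X ac j.
have da_anti m' l q : dom c q -> pd c (rshift n l) (a m') q =
    1 * \sum_k X c q ord0 (lshift n k) * pd c (rshift n l) (u k m') q.
  move=> dq; rewrite mul1r.
  rewrite -(contraction_anti X l ac dq (fun k => hu.1 k m') (Ku u hu m' q dq)).
  by rewrite -(pa m' c ac q dq) mxE.
have da_hol m' l q : dom c q -> pd c (lshift n l) (a m') q =
    -1 * \sum_k X c q ord0 (rshift n k) * pd c (lshift n l) (v k m') q.
  move=> dq; rewrite -(contraction_hol X l (Kv v hv m' q dq)).
  by rewrite -(pa m' c ac q dq) mxE.
have e1 := commutator_of_potential wick ac hu.1 hu.2 (fun k => sX (lshift n k))
  (killed_hol_component ac) (Us a sa) da_anti m (Us b sb) dp.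
have e2 := commutator_of_potential wick' ac hv.1 (karabegov_v_swap hv)
  (fun k => sX (rshift n k)) (killed_anti_component ac) (Us a sa) da_hol
  m (Us b sb) dp.
(* b star a exceeds the pointwise product by nu X^k Z_k b, and a star b falls short of it by nu
   Xbar^k Zbar_k b; the difference is nu X(b). *)
rewrite star_mul_swap in e2; rewrite /ad_star /star opprB e1 e2.
rewrite mul1r mulN1r opprD addrACA subrr add0r opprK.
case: m {e1 e2} => [|m] /=; first by rewrite addr0.
rewrite /fvact (@vact_chart _ _ _ X c (dom c) _ p
  (fun c' ac' dp' => vf_change X ac ac' dp dp')
  ac dp (@dom_open _ _ _ c) (Us b sb m) dp).
by rewrite big_split_ord.
Qed.

End Potentials.

Theorem proposition3p5 (R : realType) (n : nat) (M : complexManifold R n)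
    (w : two_form M) (hw : pseudo_kahler w)
    (S : star_product w) (hS : wick_type S)
    (K : nat -> two_form M) (hK : characterizing_form S K)
    (X : vector_field M) (hX : star_derivation S X) :
  (quasi_inner S X <->
     exists2 a : fseries M, fsmooth a & is_potential a X K) /\
  (forall a : fseries M, fsmooth a -> is_potential a X K ->
     forall b : fseries M, fsmooth b ->
       (forall m p, fvact X b m p = fvact (hamiltonian w (a 0%N)) b m p) /\
       (forall m p, numul (fvact X b) m p = (- ad_star S a b m p)%R)).
Proof.
split.
  split=> -[a sa Ha]; exists a => //.
    exact: (potential_of_implements hw hS hK hX sa Ha).
  exact: (implements_of_potential hw hS hK hX sa Ha).
move=> a sa /(implements_of_potential hw hS hK hX sa) aX b sb; split=> m p.
  exact: (implements_vact_hamiltonian p sa aX (sb m)).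
exact: aX.
Qed.
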